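(* An absolutely continuous evolution family $(w_{s,t})_{(s,t)\in\Delta(I)}$ in $\mathbb{H}$ is contained in the class $\mathfrak{BF}$ if and only if the Herglotz vector field $\phi$ associated to $(w_{s,t})$ satisfies the following condition: $\phi(\cdot,t)\in\mathcal{G}(\mathfrak{BF})$ for a.e. $t\in I$.
   Context: $\mathbb{H}:=\{z\in\mathbb{C}\colon\operatorname{Re}z>0\}$; $\mathsf{Hol}(D,E)$ is the set of holomorphic functions $f$ in $D$ with $f(D)\subset E$, with the topology of locally uniform convergence. A Bernstein function is a non-negative $C^\infty$ function $f$ on $(0,+\infty)$ such that $(-1)^{n+1}f^{(n)}(x)\ge0$ for all $x>0$ and all $n\in\mathbb{N}=\{1,2,\dots\}$. $\mathfrak{BF}$ denotes the class of all $v\in\mathsf{Hol}(\mathbb{H},\mathbb{C})$ such that $v|_{(0,+\infty)}$ is a Bernstein function that is not identically zero; $\mathfrak{BF}\subset\mathsf{Hol}(\mathbb{H},\mathbb{H})$, and $\mathfrak{BF}$ contains $\mathrm{id}_{\mathbb{H}}$, is closed under composition and is relatively closed in $\mathsf{Hol}(\mathbb{H},\mathbb{H})$. For a set $\mathfrak{U}\subset\mathsf{Hol}(\mathbb{H},\mathbb{H})$ containing $\mathrm{id}_{\mathbb{H}}$ and closed under composition, a one-parameter semigroup in $\mathfrak{U}$ is a family $(v_t)_{t\ge0}\subset\mathfrak{U}$ with $v_0=\mathrm{id}_{\mathbb{H}}$, $v_s\circ v_t=v_{s+t}$ for $s,t\ge0$, and $v_t\to\mathrm{id}_{\mathbb{H}}$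 locally uniformly as $t\to0^+$. Its infinitesimal generator is $\lim_{t\to0^+}(\mathrm{id}_{\mathbb{H}}-v_t)/t\in\mathsf{Hol}(\mathbb{H},\mathbb{C})$ (the limit always exists). $\mathcal{G}(\mathfrak{U})$ is the set of all infinitesimal generators of one-parameter semigroups contained in $\mathfrak{U}$. $I\subset\mathbb{R}$ is an interval of the form $[0,T]$ with $T\in(0,+\infty)$ or $[0,T)$ with $T\in(0,+\infty]$; $\Delta(I):=\{(s,t)\colon s,t\in I,\ s\le t\}$; $I_s:=I\cap[s,+\infty)$; $L^1_{\mathrm{loc}}(I)$ is the class of measurable functions on $I$ integrable on each compact subinterval of $I$. An absolutely continuous evolution family in $\mathbb{H}$ over $I$ is a family $(w_{s,t})_{(s,t)\in\Delta(I)}\subset\mathsf{Hol}(\mathbb{H},\mathbb{H})$ such that: EF1: $w_{s,s}=\mathrm{id}_{\mathbb{H}}$ for all $s\in I$; EF2: $w_{s,u}=w_{t,u}\circ w_{s,t}$ whenever $s\le t\le u$ in $I$; EF3: for each $z\in\mathbb{H}$ there is a non-negative $f_z\in L^1_{\mathrm{loc}}(I)$ with $|w_{s,u}(z)-w_{s,t}(z)|\le\int_t^u f_z(r)\,\mathrm{d}r$ whenever $s\le t\le u$ in $I$. A Herglotz vector field in $\mathbb{H}$ is a function $\phi\colon\mathbb{H}\times I\to\mathbb{C}$ such that: $\phi(\cdot,t)\in\mathcal{G}(\mathsf{Hol}(\mathbb{H},\mathbb{H}))$ for any $t\in I$; $\phi(z,\cdot)$ is measurable on $I$ for any $z\in\mathbb{H}$;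 and for any compact $K\subset\mathbb{H}$ there is a non-negative $M_K\in L^1_{\mathrm{loc}}(I)$ with $\max_{z\in K}|\phi(z,t)|\le M_K(t)$ for a.e. $t\in I$. Two Herglotz vector fields are identified if they agree for a.e. $t\in I$. It is known that each absolutely continuous evolution family $(w_{s,t})$ has a unique associated Herglotz vector field $\phi$, characterized by: for any $z\in\mathbb{H}$ and any $s\in[0,T)$, $I_s\ni t\mapsto w(t)=w_{s,t}(z)$ is a (locally absolutely continuous) solution of $\frac{\mathrm{d}w}{\mathrm{d}t}+\phi(w,t)=0$ for a.e. $t\in I_s$, $w(s)=z$. *)

(* Defs.v *)
From HB Require Import structures.
From mathcomp Require Import all_boot all_order all_algebra.
From mathcomp Require Import all_classical all_reals all_analysis.
From mathcomp Require Export complex.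
Set Implicit Arguments.
Unset Strict Implicit.
Unset Printing Implicit Defensive.
Import Order.TTheory GRing.Theory Num.Theory.
Import numFieldNormedType.Exports.
Local Open Scope classical_set_scope.
Local Open Scope ring_scope.
Local Open Scope complex_scope.

(* [R[i]] carries no topology of its own; [R[i]^o] is the same field with the
   topology of its modulus, as a one-dimensional normed space over itself.
   The modulus is [R[i]]-valued, hence the casts [%:C] in the estimates below:
   [x <= y] in [R[i]] means that [y - x] is a nonnegative real. *)
Notation cplx R := (R[i]^o).

Definition halfplane (R : realType) : set (cplx R) :=
  [set z | 0 < complex.Re z].
Arguments halfplane : clear implicits.

(* Functions on a domain are represented by total functions; only their values
   on the domain matter in every definition below. *)
Definition Hol (R : realType) (D E : set (cplx R)) : set (cplx R -> cplx R) :=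
  [set f | (forall z, D z -> derivable f z 1) /\ (forall z, D z -> E (f z))].

Definition bernstein (R : realType) (g : R -> R) : Prop :=
  [/\ forall x : R, 0 < x -> 0 <= g x,
      forall (n : nat) (x : R), 0 < x -> derivable (derive1n n g) x 1
    & forall (n : nat) (x : R), (0 < n)%N -> 0 < x ->
        0 <= (-1) ^+ n.+1 * derive1n n g x].

Definition BF (R : realType) : set (cplx R -> cplx R) :=
  [set v | Hol (halfplane R) setT v /\
    exists g : R -> R,
      [/\ forall x : R, 0 < x -> v x%:C = (g x)%:C,
          bernstein g
        & exists2 x, 0 < x & g x != 0]].
Arguments BF : clear implicits.

(* A one-parameter semigroup in [Hol H H] all of whose elements are in [U];
   for [U] contained in [Hol H H] this is a one-parameter semigroup in [U]. *)
Definition one_param_semigroup (R : realType) (U : set (cplx R -> cplx R))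
    (v : R -> cplx R -> cplx R) : Prop :=
  [/\ forall t : R, 0 <= t ->
        Hol (halfplane R) (halfplane R) (v t) /\ U (v t),
      forall z, halfplane R z -> v 0 z = z,
      forall (s t : R) z, 0 <= s -> 0 <= t -> halfplane R z ->
        v s (v t z) = v (s + t) z
    & {family compactly_in (halfplane R), v @ 0^'+ --> (id : cplx R -> cplx R)}].

Definition generators (R : realType) (U : set (cplx R -> cplx R)) :
    set (cplx R -> cplx R) :=
  [set G | Hol (halfplane R) setT G /\
    exists2 v, one_param_semigroup U v &
      {family compactly_in (halfplane R),
        (fun (t : R) (z : cplx R) => (z - v t z) / t%:C) @ 0^'+ --> G}].

Definition time_interval (R : realType) (T : \bar R) (I : set R) : Prop :=
  (0 < T)%E /\
  (I = [set t : R | 0 <= t /\ (t%:E < T)%E] \/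
   (T < +oo)%E /\ I = [set t : R | 0 <= t /\ (t%:E <= T)%E]).

(* [R] with the sigma-algebra of Lebesgue (not just Borel) measurable sets, on
   which [completed_lebesgue_measure] is defined. *)
Notation lebesgueR R := (caratheodory_type ((@wlength R idfun)^*)%mu).

Definition L1loc (R : realType) (I : set R) (f : R -> R) : Prop :=
  measurable_fun (I : set (lebesgueR R)) (f : lebesgueR R -> R) /\
  forall a b : R, `[a, b] `<=` I ->
    (@completed_lebesgue_measure R).-integrable
      (`[a, b]%classic : set (lebesgueR R)) (EFin \o f).

Definition evolution_family (R : realType) (I : set R)
    (w : R -> R -> cplx R -> cplx R) : Prop :=
  [/\ forall s t, I s -> I t -> s <= t ->
        Hol (halfplane R) (halfplane R) (w s t),
      forall s z, I s -> halfplane R z -> w s s z = z,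
      forall s t u z, I s -> I t -> I u -> s <= t -> t <= u ->
        halfplane R z -> w s u z = w t u (w s t z)
    & forall z, halfplane R z -> exists f : R -> R,
        [/\ L1loc I f, forall t, I t -> 0 <= f t
          & forall s t u, I s -> I t -> I u -> s <= t -> t <= u ->
              `|w s u z - w s t z| <=
              (\int[@completed_lebesgue_measure R]_(r in
                 (`[t, u]%classic : set (lebesgueR R))) f r)%:C]].

Definition herglotz_vector_field (R : realType) (I : set R)
    (phi : cplx R -> R -> cplx R) : Prop :=
  [/\ forall t, I t -> generators (Hol (halfplane R) (halfplane R)) (phi^~ t),
      forall z, halfplane R z ->
        measurable_fun (I : set (lebesgueR R))
          ((fun t => complex.Re (phi z t)) : lebesgueR R -> R) /\
        measurable_fun (I : set (lebesgueR R))
          ((fun t => complex.Im (phi z t)) : lebesgueR R -> R)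
    & forall K : set (cplx R), compact K -> K `<=` halfplane R ->
        exists M : R -> R,
        [/\ L1loc I M, forall t, I t -> 0 <= M t
          & {ae @completed_lebesgue_measure R, forall t : R, I t ->
              forall z, K z -> `|phi z t| <= (M t)%:C}]].

Definition absolutely_continuous (R : realType) (a b : R) (f : R -> cplx R) :
    Prop :=
  forall e : R, 0 < e -> exists2 d : R, 0 < d &
    forall (n : nat) (x y : 'I_n -> R),
      (forall i, [/\ a <= x i, x i <= y i & y i <= b]) ->
      (forall i j, i != j -> `]x i, y i[ `&` `]x j, y j[ = set0) ->
      \sum_(i < n) (y i - x i) < d ->
      \sum_(i < n) `|f (y i) - f (x i)| < e%:C.

(* At the (at most two) endpoints of the interval the derivative involves values
   at meaningless times; these form a null set. *)
Definition associated (R : realType) (T : \bar R) (I : set R)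
    (w : R -> R -> cplx R -> cplx R) (phi : cplx R -> R -> cplx R) : Prop :=
  forall (z : cplx R) (s : R), halfplane R z -> 0 <= s -> (s%:E < T)%E ->
    [/\ w s s z = z,
        forall a b : R, s <= a -> `[a, b] `<=` I ->
          absolutely_continuous a b (fun t => w s t z)
      & {ae @completed_lebesgue_measure R, forall t : R, I t -> s <= t ->
          (fun h : R => (w s (t + h) z - w s t z) / h%:C) @ 0^' -->
            - phi (w s t z) t}].

(* Main.v *)
(* The idea is that both implications are invariance statements for the
   Bernstein functions under a flow, and that Schwarz-Pick replaces all
   Lipschitz estimates: holomorphic self-maps of the half-plane contract the
   pseudo-hyperbolic distance.  For finitely many points [x] of [(0, +oo)] let
   [d(t)] be the infimum over positive Bernstein functions [g] of the sum of the
   distances between the flow at [x] and [g x].  Composing [g] with a map of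
   [BF] that agrees with the flow to first order shows that the upper Dini
   derivative of [d] is nonpositive; as [d] starts from [0], it vanishes, and a
   finite-pointwise limit of Bernstein functions is a Bernstein function.
   - If a.e. [phi(., t)] generates a semigroup [v] in [BF], the comparison map at
     time [t] is [v_h]; here [d] is absolutely continuous.
   - If the evolution family is in [BF], the flow is the semigroup generated by
     the frozen field [phi(., t)] and the comparison maps are [w_{t, t+h}].  The
     derivative of [h |-> w_{t, t+h}] at [0+] is known, for a.e. [t], only at the
     dense set of points [w_{s,t}(z)] with [s], [z] rational; Schwarz-Pick makes
     [(id - w_{t, t+h}) / h] almost monotone, and Minty's argument extends the
     convergence to every point.
   Schwarz-Pick itself is obtained from a discrete Goursat theorem: trapezoidal
   contour sums are exact on affine functions and additive under bisection, so
   no line integrals are needed. *)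
Require Import Defs.
From HB Require Import structures.
From mathcomp Require Import all_boot all_order all_algebra.
From mathcomp Require Import all_classical all_reals all_analysis.
From mathcomp Require Import measurable_realfun.
From mathcomp Require Import ring lra.
Set Implicit Arguments.
Unset Strict Implicit.
Unset Printing Implicit Defensive.
Import Order.TTheory GRing.Theory Num.Theory.
Import numFieldNormedType.Exports.
Local Open Scope classical_set_scope.
Local Open Scope ring_scope.

(** * The modulus and complex derivatives *)

Section Modulus.
Local Open Scope complex_scope.
Context {R : realType}.
Implicit Types (x : R) (z : R[i]).

(** Why a distance to the class and not one differential inequality per sign condition: the latter
    would need bounds on derivatives of every order along the flow, while [d] uses only values.
    Composing with a comparison map [k] costs nothing, because [k] does not increase the distance
    between the flow and [g]. The remaining error, the gap between the moved point and its image
    under [k], does not involve [g]; so near-minimizers suffice and no Gronwall factor appears.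
    Finitely many points at a time are enough because a Bernstein function bounds its second
    derivative on [a, +oo) by its value at one point, so pointwise approximation passes to the
    derivative, and likewise onwards.

    The obstacle in the second implication is that the null set of bad times depends on the
    trajectory. Only countably many trajectories can be treated at once, so at a good time the
    expansion of [w_{t,t+h}] is known on a countable set only, and no bound on the difference
    quotient elsewhere is given in advance. Almost monotonicity yields both the bound and the limit,
    since the unknown quotient enters its own estimate with a coefficient below 1. *)

Definition cabs z : R := complex.Re `|z|.

Lemma cabsE z : `|z| = (cabs z)%:C.
Proof. by rewrite /cabs normc_def. Qed.

Lemma cabs_ge0 z : 0 <= cabs z.
Proof. by rewrite -lecR -cabsE normr_ge0. Qed.

Lemma cabs0 : cabs 0 = 0.
Proof. by rewrite /cabs normr0. Qed.

Lemma cabs1 : cabs 1 = 1.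
Proof. by rewrite /cabs normr1. Qed.

Lemma cabs_eq0 z : (cabs z == 0) = (z == 0).
Proof. by rewrite -(inj_eq (@complexI R)) -cabsE normr_eq0. Qed.

Lemma cabs_gt0 z : (0 < cabs z) = (z != 0).
Proof. by rewrite lt_def cabs_eq0 cabs_ge0 andbT. Qed.

Lemma cabsM z1 z2 : cabs (z1 * z2) = cabs z1 * cabs z2.
Proof. by apply: (@complexI R); rewrite rmorphM /= -!cabsE normrM. Qed.

Lemma cabsV z : cabs z^-1 = (cabs z)^-1.
Proof. by apply: (@complexI R); rewrite fmorphV /= -!cabsE normfV. Qed.

Lemma cabsX z n : cabs (z ^+ n) = cabs z ^+ n.
Proof. by apply: (@complexI R); rewrite rmorphXn /= -!cabsE normrX. Qed.

Lemma cabsN z : cabs (- z) = cabs z.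
Proof. by rewrite /cabs normrN. Qed.

Lemma cabsB z1 z2 : cabs (z1 - z2) = cabs (z2 - z1).
Proof. by rewrite -cabsN opprB. Qed.

Lemma cabsD z1 z2 : cabs (z1 + z2) <= cabs z1 + cabs z2.
Proof. by rewrite -lecR rmorphD /= -!cabsE ler_normD. Qed.

Lemma cabs_real x : cabs x%:C = `|x|.
Proof.
by rewrite /cabs normc_def /= expr0n /= addr0 sqrtr_sqr.
Qed.

Lemma cabsJ z : cabs z^* = cabs z.
Proof. by rewrite /cabs normcJ. Qed.

Lemma cabs_sqr z : cabs z ^+ 2 = complex.Re z ^+ 2 + complex.Im z ^+ 2.
Proof.
by apply: (@complexI R); rewrite rmorphXn /= -cabsE -add_Re2_Im2.
Qed.

Lemma Re_le_cabs z : `|complex.Re z| <= cabs z.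
Proof. by rewrite -lecR -cabsE normc_ge_Re. Qed.

Lemma Im_le_cabs z : `|complex.Im z| <= cabs z.
Proof.
rewrite -(@ler_pXn2r _ 2) ?nnegrE ?normr_ge0 ?cabs_ge0 //.
by rewrite cabs_sqr real_normK ?num_real // lerDr sqr_ge0.
Qed.

Lemma cabs_le_ReIm z : cabs z <= `|complex.Re z| + `|complex.Im z|.
Proof.
rewrite -(@ler_pXn2r _ 2) ?nnegrE ?addr_ge0 ?cabs_ge0 //.
rewrite cabs_sqr sqrrD !real_normK ?num_real //.
by rewrite addrAC lerDl mulrn_wge0 // mulr_ge0.
Qed.

(** Differentiability as an estimate without quotients, in real moduli; the case [y = z] need not be
    excluded. *)
Definition cdiff (f : R[i] -> R[i]) (z l : R[i]) : Prop :=
  forall e : R, 0 < e -> exists2 d : R, 0 < d &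
    forall y, cabs (y - z) < d ->
      cabs (f y - f z - l * (y - z)) <= e * cabs (y - z).

Lemma cdiffP (f : cplx R -> cplx R) (z : cplx R) :
  derivable f z 1 -> exists l, cdiff f z l.
Proof.
move=> df; exists ('D_1 f z) => e e0.
have /cvgrPdist_le /(_ e%:C) := df.
rewrite ltcR => /(_ e0) /nbhs_ballP [d /= d0 Hd].
have d0' : 0 < complex.Re d by move: d0; rewrite ltcE /= => /andP[].
have dE : d = (complex.Re d)%:C.
  by rewrite RRe_real // realE (ltW d0).
exists (complex.Re d) => // y yd.
have [->|yz] := eqVneq y z.
  by rewrite !subrr mulr0 subr0 cabs0 mulr0.
have yz0 : y - z != 0 by rewrite subr_eq0.
have := Hd (y - z); rewrite /ball /= sub0r normrN cabsE dE ltcR => /(_ yd yz0).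
rewrite -lecR rmorphM /= -!cabsE => H.
have aux (a b c : R[i]) : c != 0 -> a - b * c = - (c * (b - c^-1 * a)).
  by move=> c0; field.
rewrite (aux _ _ _ yz0).
have -> : (y - z)^-1 * (f y - f z) =
    (y - z)^-1 *: (f ((y - z) *: (1 : cplx R) + z) - f z).
  by congr (_ *: (f _ - _)); rewrite /GRing.scale /= mulr1 subrK.
rewrite normrN normrM mulrC ler_wpM2r //.
Qed.
End Modulus.

(** * Goursat's theorem for trapezoidal sums *)

Section Goursat.
Local Open Scope complex_scope.
Context {R : realType}.
Implicit Types (g : R[i] -> R[i]) (z u v d : R[i]) (n : nat).

(* Trapezoidal sum over [2 ^ n] equal pieces of the segment from [z] to [z + d]. *)
Fixpoint trap g n z d : R[i] :=
  if n is n'.+1 then trap g n' z (d / 2) + trap g n' (z + d / 2) (d / 2)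
  else (g z + g (z + d)) / 2 * d.

Definition contour g n z u v : R[i] :=
  trap g n z u + trap g n (z + u) v - trap g n (z + v) u - trap g n z v.

(** Inner half edges are traversed twice in opposite directions and cancel. A half edge carries half
    of the pieces, hence the drop from [n.+1] to [n]: the identity is exact at every level. *)
Lemma contourS g n z u v : contour g n.+1 z u v =
  contour g n z (u / 2) (v / 2) + contour g n (z + u / 2) (u / 2) (v / 2)
  + contour g n (z + v / 2) (u / 2) (v / 2)
  + contour g n (z + u / 2 + v / 2) (u / 2) (v / 2).
Proof.
rewrite /contour /=.
have e1 : z + u / 2 + u / 2 = z + u by field.
have e2 : z + v / 2 + v / 2 = z + v by field.
have e3 : z + v / 2 + u / 2 = z + u / 2 + v / 2 by field.
have e4 : z + u / 2 + v / 2 + u / 2 = z + u + v / 2 by field.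
have e5 : z + u / 2 + v / 2 + v / 2 = z + v + u / 2 by field.
by rewrite e1 e2 e3 e4 e5; ring.
Qed.

Lemma trap_ext g1 g2 n z d : g1 =1 g2 -> trap g1 n z d = trap g2 n z d.
Proof.
by move=> e; elim: n z d => [|n IH] z d /=; rewrite ?e ?IH.
Qed.

Lemma trapD g1 g2 n z d :
  trap (fun y => g1 y + g2 y) n z d = trap g1 n z d + trap g2 n z d.
Proof. by elim: n z d => [|n IH] z d /=; [ring | rewrite !IH; ring]. Qed.

Lemma trapZ c g n z d : trap (fun y => c * g y) n z d = c * trap g n z d.
Proof. by elim: n z d => [|n IH] z d /=; [ring | rewrite !IH; ring]. Qed.

Lemma trap_affine a b n z d :
  trap (fun y => a + b * y) n z d = a * d + b * (z * d + d ^+ 2 / 2).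
Proof. by elim: n z d => [|n IH] z d /=; [field | rewrite !IH; field]. Qed.

Lemma contour_affine a b n z u v : contour (fun y => a + b * y) n z u v = 0.
Proof. by rewrite /contour !trap_affine; field. Qed.

Lemma contourD g1 g2 n z u v : contour (fun y => g1 y + g2 y) n z u v =
  contour g1 n z u v + contour g2 n z u v.
Proof. by rewrite /contour !trapD; ring. Qed.

Lemma contourZ c g n z u v :
  contour (fun y => c * g y) n z u v = c * contour g n z u v.
Proof. by rewrite /contour !trapZ; ring. Qed.

Lemma contour_ext g1 g2 n z u v : g1 =1 g2 ->
  contour g1 n z u v = contour g2 n z u v.
Proof. by move=> e; rewrite /contour !(trap_ext _ _ _ e). Qed.

Lemma trap_bound g B n z d :
  (forall t : R, 0 <= t <= 1 -> cabs (g (z + t%:C * d)) <= B) ->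
  cabs (trap g n z d) <= B * cabs d.
Proof.
elim: n z d => [|n IH] z d H /=.
  rewrite cabsM ler_wpM2r ?cabs_ge0 //.
  rewrite cabsM cabsV (_ : 2 = (2 : R)%:C); last by rewrite rmorph_nat.
  rewrite cabs_real ger0_norm // ler_pdivrMr // mulr_natr mulr2n.
  apply: (le_trans (cabsD _ _)); apply: lerD.
    by have := H 0; rewrite lexx ler01 rmorph0 mul0r addr0; apply.
  by have := H 1; rewrite lexx ler01 rmorph1 mul1r; apply.
apply: (le_trans (cabsD _ _)).
have h2 : cabs (d / 2) = cabs d / 2.
  rewrite cabsM cabsV (_ : 2 = (2 : R)%:C); last by rewrite rmorph_nat.
  by rewrite cabs_real ger0_norm // rmorph_nat.
have tC (t : R) : t%:C * (d / 2) = (t / 2)%:C * d.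
  by rewrite rmorphM fmorphV rmorph_nat /=; ring.
have -> : B * cabs d = B * cabs (d / 2) + B * cabs (d / 2).
  by rewrite h2; field.
apply: lerD; apply: IH => t /andP[t0 t1].
  rewrite tC; apply: H; apply/andP; split; lra.
rewrite -addrA tC (_ : d / 2 + (t / 2)%:C * d = ((1 + t) / 2)%:C * d).
  apply: H; apply/andP; split; lra.
by rewrite !rmorphM !rmorphD !fmorphV !rmorph_nat /= rmorph1; ring.
Qed.

Definition inpar z u v (y : R[i]) : Prop := exists a b : R,
  [/\ 0 <= a <= 1, 0 <= b <= 1 & y = z + a%:C * u + b%:C * v].

Definition onpar z u v (y : R[i]) : Prop := exists2 t : R, 0 <= t <= 1 &
  [\/ y = z + t%:C * u, y = z + u + t%:C * v, y = z + v + t%:C * u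
    | y = z + t%:C * v].

Lemma onpar_inpar z u v y : onpar z u v y -> inpar z u v y.
Proof.
have r01 : (0:R) <= 0 <= (1:R) by rewrite lexx ler01.
have r11 : (0:R) <= 1 <= (1:R) by rewrite lexx ler01.
move=> [t t01 [] ->]; [exists t, 0|exists 1, t|exists t, 1|exists 0, t];
  by split=> //; rewrite ?rmorph0 ?rmorph1; ring.
Qed.

Lemma contour_bound g B n z u v :
  (forall y, onpar z u v y -> cabs (g y) <= B) ->
  cabs (contour g n z u v) <= 2 * B * (cabs u + cabs v).
Proof.
move=> H; rewrite /contour.
have h1 : cabs (trap g n z u) <= B * cabs u.
  by apply: trap_bound => t ht; apply: H; exists t => //; apply: Or41.
have h2 : cabs (trap g n (z + u) v) <= B * cabs v.
  by apply: trap_bound => t ht; apply: H; exists t => //; apply: Or42.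
have h3 : cabs (trap g n (z + v) u) <= B * cabs u.
  by apply: trap_bound => t ht; apply: H; exists t => //; apply: Or43.
have h4 : cabs (trap g n z v) <= B * cabs v.
  by apply: trap_bound => t ht; apply: H; exists t => //; apply: Or44.
have t1 := cabsD (trap g n z u + trap g n (z + u) v - trap g n (z + v) u) (- trap g n z v).
have t2 := cabsD (trap g n z u + trap g n (z + u) v) (- trap g n (z + v) u).
have t3 := cabsD (trap g n z u) (trap g n (z + u) v).
rewrite !cabsN in t1 t2.
lra.
Qed.

(* A form of [limsup <= c] that is additive under subdivision of the contour. *)
Definition contour_evle g z u v (c : R) : Prop :=
  exists N, forall n, (N <= n)%N -> cabs (contour g n z u v) <= c.

Lemma contour_evle_split g z u v c1 c2 c3 c4 :
  contour_evle g z (u / 2) (v / 2) c1 -> contour_evle g (z + u / 2) (u / 2) (v / 2) c2 ->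
  contour_evle g (z + v / 2) (u / 2) (v / 2) c3 ->
  contour_evle g (z + u / 2 + v / 2) (u / 2) (v / 2) c4 ->
  contour_evle g z u v (c1 + c2 + c3 + c4).
Proof.
move=> [N1 H1] [N2 H2] [N3 H3] [N4 H4].
exists (maxn (maxn N1 N2) (maxn N3 N4)).+1 => -[//|n].
rewrite ltnS !geq_max => /andP[/andP[n1 n2] /andP[n3 n4]].
rewrite contourS.
do 3 (apply: (le_trans (cabsD _ _)); apply: lerD; last by auto).
by auto.
Qed.

Lemma contour_evle_mono g z u v (c1 c2 : R) : c1 <= c2 -> contour_evle g z u v c1 ->
  contour_evle g z u v c2.
Proof. by move=> c12 [N H]; exists N => n /H /le_trans; apply. Qed.

Lemma inpar_cabs z u v y1 y2 : inpar z u v y1 -> inpar z u v y2 ->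
  cabs (y1 - y2) <= cabs u + cabs v.
Proof.
move=> [a1 [b1 [/andP[a10 a11] /andP[b10 b11] ->]]].
move=> [a2 [b2 [/andP[a20 a21] /andP[b20 b21] ->]]].
have -> : z + a1%:C * u + b1%:C * v - (z + a2%:C * u + b2%:C * v) =
  (a1 - a2)%:C * u + (b1 - b2)%:C * v by rewrite !rmorphB /=; ring.
apply: (le_trans (cabsD _ _)); rewrite !cabsM !cabs_real.
have [u0 v0] := (cabs_ge0 u, cabs_ge0 v).
by apply: lerD; rewrite ler_piMl // ler_norml; apply/andP; split; lra.
Qed.

(** The affine part of [g] at [y] has contour sum 0; the remainder is at most [e] times the size of
    the parallelogram, on a perimeter of the same order. Being quadratic, the bound keeps pace with
    the factor 4 lost in each bisection. *)
Lemma contour_evle_affine g z u v y l (e d : R) : 0 <= e -> inpar z u v y ->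
  (forall y', cabs (y' - y) < d -> cabs (g y' - g y - l * (y' - y)) <= e * cabs (y' - y)) ->
  cabs u + cabs v < d ->
  contour_evle g z u v (2 * e * (cabs u + cabs v) ^+ 2).
Proof.
move=> e0 yz Hd uvd; exists 0%N => n _.
pose r y' := g y' - g y - l * (y' - y).
have -> : contour g n z u v = contour r n z u v.
  rewrite (@contour_ext g (fun y' => (g y - l * y + l * y') + r y')); last first.
    by move=> y'; rewrite /r; ring.
  by rewrite contourD contour_affine add0r.
have : cabs (contour r n z u v) <= 2 * (e * (cabs u + cabs v)) * (cabs u + cabs v).
  apply: contour_bound => y' /onpar_inpar y'z.
  have h := inpar_cabs y'z yz.
  apply: (le_trans (Hd _ (le_lt_trans h uvd))).
  by rewrite ler_wpM2l.
by move/le_trans; apply; rewrite -!mulrA expr2.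
Qed.
End Goursat.

(** * Goursat's theorem by dyadic bisection, with exceptional points *)

Section Goursat2.
Local Open Scope complex_scope.
Context {R : realType}.
Implicit Types (g : R[i] -> R[i]) (z u v d : R[i]) (n k m : nat).

Definition dyad k : R := 2^-1 ^+ k.

Lemma dyad_gt0 k : 0 < dyad k.
Proof. by rewrite exprn_gt0. Qed.

Lemma dyadS k : dyad k.+1 = dyad k / 2.
Proof. by rewrite /dyad exprSr. Qed.

Lemma dyad0 : dyad 0 = 1.
Proof. by []. Qed.

Lemma dyad_small (A e : R) : 0 < e -> exists k, A * dyad k < e.
Proof.
move=> e0.
have [n Hn] : exists n, `|A| / e < n%:R.
  exists (Num.truncn (`|A| / e)).+1; exact: truncnS_gt.
exists n; apply: (le_lt_trans (ler_wpM2r (ltW (dyad_gt0 n)) (ler_norm A))).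
rewrite /dyad exprVn ltr_pdivrMr ?exprn_gt0 //.
move: Hn; rewrite ltr_pdivrMr // => /lt_trans; apply.
by rewrite mulrC ltr_pM2l // -natrX ltr_nat ltn_expl.
Qed.

Lemma nested_dyadic (a : nat -> R) :
  (forall k, a k <= a k.+1) ->
  (forall k, a k.+1 + dyad k.+1 <= a k + dyad k) ->
  exists x, forall k, a k <= x <= a k + dyad k.
Proof.
move=> inc dec.
have inc' : {homo a : m n / (m <= n)%N >-> m <= n}.
  by apply: homo_leq => //; exact: le_trans.
have dec' m n : (m <= n)%N -> a n + dyad n <= a m + dyad m.
  move=> /subnK <-; elim: (n - m)%N => [|j IH]; first by rewrite add0n.
  by apply: le_trans IH; rewrite addSn.
have ub k : ubound (range a) (a k + dyad k).
  move=> _ [n _ <-].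
  have [nk|/ltnW kn] := leqP n k.
    by apply: (le_trans (inc' _ _ nk)); rewrite lerDl (ltW (dyad_gt0 k)).
  by apply: le_trans (dec' _ _ kn); rewrite lerDl (ltW (dyad_gt0 n)).
exists (sup (range a)) => k; apply/andP; split.
  apply: ub_le_sup; first by exists (a 0%N + dyad 0).
  by exists k.
by apply: ge_sup => //; exists (a 0%N), 0%N.
Qed.

Lemma dyad_halve k d : (dyad k)%:C * d / 2 = (dyad k.+1)%:C * d.
Proof. by rewrite dyadS !rmorphM fmorphV !rmorph_nat /=; ring. Qed.

(** If the bound [c] failed, some quarter would fail the bound [c / 4], and so on. The nested pieces
    shrink to a point, where differentiability gives a bound of order [4^-k] with an arbitrarily
    small factor. Pieces are tracked by the corner's coordinates in the unit square, so [u] and [v]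
    may be dependent or zero. *)
Lemma goursat g z u v (c : R) :
  (forall y, inpar z u v y -> exists l, cdiff g y l) -> 0 < c ->
  contour_evle g z u v c.
Proof.
move=> reg c0.
pose pt (s : R * R) := z + (s.1)%:C * u + (s.2)%:C * v.
pose P k s := ~ contour_evle g (pt s) ((dyad k)%:C * u) ((dyad k)%:C * v) (c / 4 ^+ k).
apply: contrapT => nE.
have P0 : P 0%N (0, 0).
  rewrite /P /pt /= !rmorph0 !mul0r !addr0 dyad0 !rmorph1 !mul1r expr0 divr1.
  exact: nE.
pose nxt k (s s' : R * R) := [/\ s.1 <= s'.1, s'.1 + dyad k.+1 <= s.1 + dyad k,
  s.2 <= s'.2 & s'.2 + dyad k.+1 <= s.2 + dyad k].
have step k s : P k s -> exists s', P k.+1 s' /\ nxt k s s'.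
  move=> Ps; apply: contrapT => nex; apply: Ps.
  have dk := dyad_gt0 k.
  have all4 s' : nxt k s s' -> contour_evle g (pt s') ((dyad k.+1)%:C
    * u) ((dyad k.+1)%:C * v) (c / 4 ^+ k.+1).
    by move=> ns; apply: contrapT => nP; apply: nex; exists s'.
  have -> : c / 4 ^+ k = c / 4 ^+ k.+1 + c / 4 ^+ k.+1 + c / 4 ^+ k.+1 + c / 4 ^+ k.+1.
    by rewrite exprS invfM; field; rewrite expf_neq0.
  apply: contour_evle_split; rewrite !dyad_halve.
  - by apply: all4; split; rewrite ?dyadS; lra.
  - have := all4 (s.1 + dyad k.+1, s.2); rewrite /pt /=.
    have -> : z + (s.1 + dyad k.+1)%:C * u + (s.2)%:C * v =
      z + (s.1)%:C * u + (s.2)%:C * v + (dyad k.+1)%:C * u.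
      by rewrite rmorphD /=; ring.
    apply; split=> /=; rewrite ?dyadS; lra.
  - have := all4 (s.1, s.2 + dyad k.+1); rewrite /pt /=.
    have -> : z + (s.1)%:C * u + (s.2 + dyad k.+1)%:C * v =
      z + (s.1)%:C * u + (s.2)%:C * v + (dyad k.+1)%:C * v.
      by rewrite rmorphD /=; ring.
    apply; split=> /=; rewrite ?dyadS; lra.
  - have := all4 (s.1 + dyad k.+1, s.2 + dyad k.+1); rewrite /pt /=.
    have -> : z + (s.1 + dyad k.+1)%:C * u + (s.2 + dyad k.+1)%:C * v =
      z + (s.1)%:C * u + (s.2)%:C * v + (dyad k.+1)%:C * u + (dyad k.+1)%:C * v.
      by rewrite !rmorphD /=; ring.
    apply; split=> /=; rewrite ?dyadS; lra.
have step' (ks : nat * (R * R)) : exists s', P ks.1 ks.2 ->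
  P ks.1.+1 s' /\ nxt ks.1 ks.2 s'.
  have [Pk|nPk] := pselect (P ks.1 ks.2); last by exists (0, 0).
  by have [s' Hs'] := step _ _ Pk; exists s'.
have [f Hf] := choice step'.
pose fix sq k := if k is k'.+1 then f (k', sq k') else (0, 0).
have Psq k : P k (sq k).
  by elim: k => [//|k IH]; have [] := Hf (k, sq k) IH.
have nsq k : nxt k (sq k) (sq k.+1) by have [] := Hf (k, sq k) (Psq k).
have [x Hx] := @nested_dyadic (fun k => (sq k).1)
  (fun k => let: And4 h _ _ _ := nsq k in h) (fun k => let: And4 _ h _ _ := nsq k in h).
have [y Hy] := @nested_dyadic (fun k => (sq k).2)
  (fun k => let: And4 _ _ h _ := nsq k in h) (fun k => let: And4 _ _ _ h := nsq k in h).
have inQ k : inpar (pt (sq k)) ((dyad k)%:C * u) ((dyad k)%:C * v) (pt (x, y)).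
  have dk := dyad_gt0 k.
  exists ((x - (sq k).1) / dyad k), ((y - (sq k).2) / dyad k).
  have /andP[x1 x2] := Hx k; have /andP[y1 y2] := Hy k.
  split; try by rewrite divr_ge0 ?ler_pdivrMr ?subr_ge0 ?(ltW dk) //= mul1r lerBlDl.
  rewrite /pt /= !mulrA -!rmorphM /= !divfK ?gt_eqF // !rmorphB /=; ring.
have [l Hl] : exists l, cdiff g (pt (x, y)) l.
  apply: reg; have := inQ 0%N.
  by rewrite /= /pt /= !rmorph0 !mul0r !addr0 dyad0 !rmorph1 !mul1r.
pose S := cabs u + cabs v.
have S0 : 0 <= S by rewrite addr_ge0 ?cabs_ge0.
have SP : 0 < 2 * (S ^+ 2 + 1) by rewrite mulr_gt0 // ltr_wpDl ?sqr_ge0.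
(* With this precision [2 * e * S^2 <= c]; the added 1 covers [S = 0]. *)
have e0 : 0 < c / (2 * (S ^+ 2 + 1)) by rewrite divr_gt0.
have [d d0 Hd] := Hl _ e0.
have [k Hk] := dyad_small S d0.
apply: (Psq k).
have Sk : cabs ((dyad k)%:C * u) + cabs ((dyad k)%:C * v) = S * dyad k.
  by rewrite !cabsM !cabs_real ger0_norm ?(ltW (dyad_gt0 k)) // -mulrDr mulrC.
have := contour_evle_affine (ltW e0) (inQ k) Hd.
rewrite Sk => /(_ Hk); apply: contour_evle_mono.
have -> : 4 ^+ k = (dyad k ^+ 2)^-1.
  by rewrite /dyad -exprM mulnC exprM -exprVn; congr (_ ^+ k); field.
have S1 : 0 < S ^+ 2 + 1 by rewrite ltr_wpDl ?sqr_ge0.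
have -> : 2 * (c / (2 * (S ^+ 2 + 1))) * (S * dyad k) ^+ 2 =
    c * dyad k ^+ 2 * (S ^+ 2 / (S ^+ 2 + 1)).
  by field; rewrite gt_eqF.
rewrite invrK ler_piMr ?mulr_ge0 ?(ltW c0) ?(ltW (dyad_gt0 k)) //.
by rewrite ler_pdivrMr // mul1r lerDl.
Qed.

(* Both half-open conventions are summed, so that the weight is additive in the
   interval and yet positive at both endpoints. *)
Definition itv_weight (a h x : R) : R := (a <= x < a + h)%R%:R + (a < x <= a + h)%R%:R.

Lemma itv_weight_ge0 a h x : 0 <= itv_weight a h x.
Proof. by rewrite addr_ge0. Qed.

Lemma itv_weight_split a h x : 0 < h -> itv_weight a h x =
  itv_weight a (h / 2) x + itv_weight (a + h / 2) (h / 2) x.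
Proof.
move=> h0; rewrite /itv_weight.
have -> : a + h / 2 + h / 2 = a + h by field.
have [ax|xa] := leP a x; have [ax'|xa'] := ltP a x;
have [bx|xb] := leP (a + h) x; have [bx'|xb'] := ltP (a + h) x;
have [cx|xc] := leP (a + h / 2) x; have [cx'|xc'] := ltP (a + h / 2) x => /=;
rewrite ?addr0 ?add0r //; try (exfalso; lra); ring.
Qed.

Lemma itv_weight_ge1 a h x : 0 < h -> a <= x <= a + h -> 1 <= itv_weight a h x.
Proof.
move=> h0 /andP[ax xah]; rewrite /itv_weight ax xah andbT /=.
case: ltP => [_|ahx]; first by rewrite lerDl.
by rewrite (_ : a < x) ?add0r //; lra.
Qed.

Definition square_weight (es : seq (R * R)) (a b h : R) : R :=
  \sum_(e <- es) itv_weight a h e.1 * itv_weight b h e.2.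

Lemma square_weight_split es a b h : 0 < h -> square_weight es a b h =
  square_weight es a b (h / 2) + square_weight es (a + h / 2) b (h / 2)
    + square_weight es a (b + h / 2) (h / 2)
  + square_weight es (a + h / 2) (b + h / 2) (h / 2).
Proof.
move=> h0; rewrite /square_weight -!big_split /=; apply: eq_bigr => e _.
by rewrite (itv_weight_split a) // (itv_weight_split b) //; ring.
Qed.

Lemma square_weight_ge1 es a b h e : 0 < h -> e \in es -> a <= e.1 <= a + h ->
  b <= e.2 <= b + h ->
  1 <= square_weight es a b h.
Proof.
move=> h0 ees ha hb; rewrite /square_weight (big_rem e) //=.
rewrite ler_wpDr //; first by apply: sumr_ge0 => i _; rewrite mulr_ge0 ?itv_weight_ge0.
by rewrite -[1]mulr1 ler_pM ?itv_weight_ge1.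
Qed.

(* In a dyadic subdivision the squares that meet an exceptional point have a
   bounded total weight, while their perimeters tend to 0. *)
Lemma goursat_exceptional g z u v (es : seq (R * R)) (B : R) :
  (forall y, inpar z u v y -> cabs (g y) <= B) ->
  (forall a b : R, 0 <= a <= 1 -> 0 <= b <= 1 -> (a, b) \notin es ->
     exists l, cdiff g (z + a%:C * u + b%:C * v) l) ->
  forall c : R, 0 < c -> contour_evle g z u v c.
Proof.
move=> bdd reg.
pose A := 2 * B * (cabs u + cabs v).
have A0 : 0 <= A.
  rewrite mulr_ge0 ?addr_ge0 ?cabs_ge0 // mulr_ge0 //.
  apply: le_trans (cabs_ge0 _) (bdd z _); exists 0, 0.
  by rewrite lexx ler01 rmorph0 !mul0r !addr0.
(* Induction on the number [k] of bisections still to be made in a square of side [dyad m]. At the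
   end, a square of weight 0 contains no exceptional point and Goursat's theorem applies; any other
   has weight at least 1, which pays for the crude bound [A * dyad m]. *)
have key k m a b (c : R) : 0 <= a -> a + dyad m <= 1 -> 0 <= b -> b + dyad m <= 1 ->
    0 < c -> contour_evle g (z + a%:C * u + b%:C * v) ((dyad m)%:C * u) ((dyad m)%:C * v)
     (square_weight es a b (dyad m) * (A * dyad m * dyad k) + c).
  elim: k m a b c => [|k IH] m a b c a0 a1 b0 b1 c0; last first.
    have dm := dyad_gt0 m.
    have dE : dyad m * dyad k.+1 = dyad m.+1 * dyad k by rewrite !dyadS; ring.
    have := @contour_evle_split R g (z + a%:C * u
      + b%:C * v) ((dyad m)%:C * u) ((dyad m)%:C * v) _ _ _ _.
    rewrite !dyad_halve => H.
    have dmS : dyad m.+1 + dyad m.+1 = dyad m by rewrite dyadS; field.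
    have dm1 := dyad_gt0 m.+1.
    have c4 : 0 < c / 4 by rewrite divr_gt0.
    have h1 := IH m.+1 a b (c / 4) a0 ltac:(lra) b0 ltac:(lra) c4.
    have h2 := IH m.+1 (a + dyad m.+1) b (c / 4) ltac:(lra) ltac:(lra) b0 ltac:(lra) c4.
    have h3 := IH m.+1 a (b + dyad m.+1) (c / 4) a0 ltac:(lra) ltac:(lra) ltac:(lra) c4.
    have h4 := IH m.+1 (a + dyad m.+1) (b
      + dyad m.+1) (c / 4) ltac:(lra) ltac:(lra) ltac:(lra) ltac:(lra) c4.
    have e2 : z + (a + dyad m.+1)%:C * u + b%:C * v =
      z + a%:C * u + b%:C * v + (dyad m.+1)%:C * u.
      by rewrite rmorphD /=; ring.
    have e3 : z + a%:C * u + (b + dyad m.+1)%:C * v =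
      z + a%:C * u + b%:C * v + (dyad m.+1)%:C * v.
      by rewrite rmorphD /=; ring.
    have e4 : z + (a + dyad m.+1)%:C * u + (b + dyad m.+1)%:C * v =
      z + a%:C * u + b%:C * v + (dyad m.+1)%:C * u + (dyad m.+1)%:C * v.
      by rewrite !rmorphD /=; ring.
    rewrite e2 in h2; rewrite e3 in h3; rewrite e4 in h4.
    have := H _ _ _ _ h1 h2 h3 h4; apply: contour_evle_mono.
    rewrite (square_weight_split es a b dm) -dyadS -!mulrA dE le_eqVlt; apply/orP; left;
      apply/eqP.
    by field.
  have dm := dyad_gt0 m.
  have [om0|om_ne0] := eqVneq (square_weight es a b (dyad m)) 0.
    rewrite om0 mul0r add0r; apply: goursat => // y [s [t [s01 t01 ->]]].
    have -> : z + a%:C * u + b%:C * v + s%:C * ((dyad m)%:C * u) + t%:C * ((dyad m)%:C * v)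
       = z + (a + s * dyad m)%:C * u + (b + t * dyad m)%:C * v.
      by rewrite !rmorphD !rmorphM /=; ring.
    move/andP: s01 => [s0 s1]; move/andP: t01 => [t0 t1].
    have sm0 : 0 <= s * dyad m by rewrite mulr_ge0 // ltW.
    have sm1 : s * dyad m <= dyad m by rewrite ler_piMl // ltW.
    have tm0 : 0 <= t * dyad m by rewrite mulr_ge0 // ltW.
    have tm1 : t * dyad m <= dyad m by rewrite ler_piMl // ltW.
    apply: reg; try by apply/andP; split; lra.
    apply/negP => ees.
    have : 1 <= square_weight es a b (dyad m).
      by apply: (square_weight_ge1 dm ees) => /=; apply/andP; split; lra.
    by rewrite om0; lra.
  have om1 : 1 <= square_weight es a b (dyad m).
    have : has (fun e => itv_weight a (dyad m) e.1 * itv_weight b (dyad m) e.2 != 0) es.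
      apply: contraNT om_ne0 => /hasPn h; apply/eqP;
        rewrite /square_weight big_seq big1 // => e /h.
      by rewrite negbK => /eqP.
    move=> /hasP[e ees]; rewrite mulf_eq0 negb_or => /andP[].
    have omN0 (x w : R) : itv_weight w (dyad m) x != 0 -> w <= x <= w + dyad m.
      rewrite /itv_weight; clear; have [wx|xw] := leP w x;
        have [xd|dx] := leP x (w + dyad m) => //=.
      - by rewrite (lt_gtF dx) /= andbF addr0 eqxx.
      - by rewrite (lt_gtF xw) /= addr0 eqxx.
      - by rewrite (lt_gtF xw) /= addr0 eqxx.
    by move=> /omN0 h1 /omN0 h2; apply: (square_weight_ge1 dm ees).
  exists 0%N => n _.
  rewrite dyad0 mulr1.
  have : cabs (contour g n (z + a%:C * u
    + b%:C * v) ((dyad m)%:C * u) ((dyad m)%:C * v)) <= A * dyad m.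
    have -> : A * dyad m = 2 * B * (cabs ((dyad m)%:C * u) + cabs ((dyad m)%:C * v)).
      by rewrite !cabsM !cabs_real ger0_norm ?(ltW dm) // /A; ring.
    apply: contour_bound => y /onpar_inpar[s [t [/andP[s0 s1] /andP[t0 t1] ->]]].
    apply: bdd; exists (a + s * dyad m), (b + t * dyad m).
    have sm0 : 0 <= s * dyad m by rewrite mulr_ge0 // ltW.
    have sm1 : s * dyad m <= dyad m by rewrite ler_piMl // ltW.
    have tm0 : 0 <= t * dyad m by rewrite mulr_ge0 // ltW.
    have tm1 : t * dyad m <= dyad m by rewrite ler_piMl // ltW.
    split; [by apply/andP; split; lra | by apply/andP; split; lra |].
    by rewrite !rmorphD !rmorphM /=; ring.
  move/le_trans; apply; rewrite ler_wpDr ?(ltW c0) // ler_peMl // mulr_ge0 // ltW //.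
move=> c c0.
have c2 : 0 < c / 2 by rewrite divr_gt0.
have [k Hk] := dyad_small (square_weight es 0 0 1 * A) c2.
have := key k 0%N 0 0 (c / 2) (lexx _) _ (lexx _) _ c2.
rewrite add0r dyad0 rmorph0 rmorph1 !mul0r !addr0 !mul1r mulr1 => /(_ (lexx _) (lexx _)).
apply: contour_evle_mono; rewrite mulrA; lra.
Qed.
End Goursat2.

(** * The maximum principle and the Schwarz-Pick lemma *)

Section MaxPrinciple.
Local Open Scope complex_scope.
Context {R : realType}.
Implicit Types (g f : R[i] -> R[i]) (z u v d : R[i]) (n k m : nat).
Local Notation Re := complex.Re.
Local Notation Im := complex.Im.

Lemma Im_half (w : R[i]) : Im (w / 2) = Im w / 2.
Proof.
rewrite (_ : w / 2 = w * (2^-1)%:C); last by rewrite fmorphV rmorph_nat.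
by case: w => a b /=; rewrite mulr0 add0r.
Qed.

Lemma trap_Im_ge g (B : R) n z d :
  (forall t : R, 0 <= t <= 1 -> B <= Im (g (z + t%:C * d) * d)) ->
  B <= Im (trap g n z d).
Proof.
elim: n z d B => [|n IH] z d B H /=.
  have -> : (g z + g (z + d)) / 2 * d = (g z * d + g (z + d) * d) / 2 by ring.
  rewrite Im_half raddfD /= ler_pdivlMr // mulr_natr mulr2n.
  apply: lerD.
    by have := H 0; rewrite rmorph0 mul0r addr0; apply; rewrite lexx ler01.
  by have := H 1; rewrite rmorph1 mul1r; apply; rewrite lexx ler01.
have tC (t : R) : t%:C * (d / 2) = (t / 2)%:C * d.
  by rewrite rmorphM fmorphV rmorph_nat /=; ring.
rewrite raddfD /= (splitr B).
apply: lerD; apply: IH => t /andP[t0 t1]; rewrite mulrA Im_half ler_pM2r //.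
  rewrite tC; apply: H; apply/andP; split; lra.
rewrite -addrA tC (_ : d / 2 + (t / 2)%:C * d = ((1 + t) / 2)%:C * d).
  apply: H; apply/andP; split; lra.
by rewrite !rmorphM !rmorphD !fmorphV !rmorph_nat /= rmorph1; ring.
Qed.

Lemma trap_Im_le0 g n z d :
  (forall t : R, 0 <= t <= 1 -> Im (g (z + t%:C * d) * d) <= 0) ->
  Im (trap g n z d) <= 0.
Proof.
move=> H; rewrite -oppr_ge0 -raddfN /= -mulN1r -trapZ.
apply: trap_Im_ge => t t01.
by rewrite -mulrA mulN1r raddfN oppr_ge0; apply: H.
Qed.

Lemma ReV z : Re z^-1 = Re z / cabs z ^+ 2.
Proof. by rewrite cabs_sqr; case: z => a b. Qed.

Lemma ImV z : Im z^-1 = - Im z / cabs z ^+ 2.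
Proof. by rewrite cabs_sqr mulNr; case: z => a b. Qed.

Lemma ReB (a b : R[i]) : Re (a - b) = Re a - Re b.
Proof. by rewrite raddfB. Qed.

Lemma ImB (a b : R[i]) : Im (a - b) = Im a - Im b.
Proof. by rewrite raddfB. Qed.

(* Applied to all powers of a function, this removes the constant from a
   Cauchy estimate. *)
Lemma le_of_exprn_le (a b c : R) : 0 < b -> (forall n, a ^+ n <= c * b ^+ n) -> a <= b.
Proof.
move=> b0 H; rewrite leNgt; apply/negP => ba.
pose r := a / b - 1.
have r0 : 0 < r by rewrite subr_gt0 ltr_pdivlMr // mul1r.
have aE : a = b * (1 + r) by rewrite /r; field; rewrite gt_eqF.
have bern n : 1 + n%:R * r <= (1 + r) ^+ n.
  elim: n => [|n IH]; first by rewrite mul0r addr0 expr0.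
  rewrite exprS; apply: (@le_trans _ _ ((1 + r) * (1 + n%:R * r))).
    rewrite -natr1.
    have : 0 <= r * (n%:R * r) by rewrite !mulr_ge0 // ltW.
    lra.
  by rewrite ler_wpM2l // addr_ge0 // ltW.
pose n := (Num.truncn (`|c| / r)).+1.
have Hn : `|c| / r < n%:R by exact: truncnS_gt.
have := H n; rewrite aE exprMn mulrC ler_pM2r ?exprn_gt0 // => h.
have := le_trans (bern n) h.
move: Hn; rewrite ltr_pdivrMr // => h1.
have := ler_norm c; lra.
Qed.

Definition inrect (x0 y0 L H : R) (y : R[i]) : Prop :=
  x0 <= Re y <= x0 + L /\ y0 <= Im y <= y0 + H.
Definition onrect (x0 y0 L H : R) (y : R[i]) : Prop :=
  inrect x0 y0 L H y /\
  [\/ Re y = x0, Re y = x0 + L, Im y = y0 | Im y = y0 + H].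

Lemma inpar_rect (x0 y0 L H : R) (a b : R) :
  (x0 +i* y0) + a%:C * L%:C + b%:C * (0 +i* H) = (x0 + a * L) +i* (y0 + b * H) :> R[i].
Proof. by apply/eqP; rewrite eq_complex /=; apply/andP; split; apply/eqP; ring. Qed.

Lemma onpar_onrect x0 y0 (L H : R) y : 0 < L -> 0 < H ->
  onpar (x0 +i* y0) L%:C (0 +i* H) y -> onrect x0 y0 L H y.
Proof.
move=> L0 H0 [t /andP[t0 t1]].
have tL0 : 0 <= t * L by rewrite mulr_ge0 // ltW.
have tL1 : t * L <= L by rewrite ler_piMl // ltW.
have tH0 : 0 <= t * H by rewrite mulr_ge0 // ltW.
have tH1 : t * H <= H by rewrite ler_piMl // ltW.
by case=> -> /=; (split; first by split; apply/andP; split=> /=; lra);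
  [apply: Or43|apply: Or42|apply: Or44|apply: Or41] => /=; ring.
Qed.

(** Seen from [p], the angle increases along the whole boundary, so all four sides contribute with
    the same sign to the imaginary part. The right side, at distance [a] from [p], already
    contributes [H * a / (a^2 + H^2)]; this lower bound replaces the exact value of the winding
    integral. *)
Lemma contour_kernel (p : R[i]) (x0 y0 L H : R) :
  x0 < Re p < x0 + L -> y0 < Im p < y0 + H ->
  exists2 c0 : R, 0 < c0 & forall n,
    c0 <= cabs (contour (fun y => (y - p)^-1) n (x0 +i* y0) L%:C (0 +i* H)).
Proof.
move=> /andP[px0 px1] /andP[py0 py1].
pose a := x0 + L - Re p.
have a0 : 0 < a by rewrite subr_gt0.
have H0 : 0 < H by lra.
have L0 : 0 < L by lra.
have D0 : 0 < a ^+ 2 + H ^+ 2 by rewrite ltr_pwDl ?sqr_ge0 ?exprn_gt0.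
exists (H * (a / (a ^+ 2 + H ^+ 2))) => [|n]; first by rewrite !mulr_gt0 ?invr_gt0.
have imR (w : R[i]) (s : R) : Im (w * s%:C) = s * Im w by case: w => ? ? /=; ring.
have imI (w : R[i]) (s : R) : Im (w * (0 +i* s)) = s * Re w by case: w => ? ? /=; ring.
have tH (t : R) : 0 <= t <= 1 -> 0 <= t * H <= H.
  by move=> /andP[t0 t1]; rewrite mulr_ge0 ?(ltW H0) //= ler_piMl // ltW.
apply: le_trans (Im_le_cabs _); apply: le_trans (ler_norm _).
rewrite /contour !ImB raddfD /=.
have h1 : 0 <= Im (trap (fun y => (y - p)^-1) n (x0 +i* y0) L%:C).
  apply: trap_Im_ge => t t01; rewrite imR mulr_ge0 ?(ltW L0) // ImV divr_ge0 ?sqr_ge0 //.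
  rewrite oppr_ge0 ImB raddfD /= mul0r mulr0 !addr0; lra.
have h2 : H * (a / (a ^+ 2 + H ^+ 2)) <=
    Im (trap (fun y => (y - p)^-1) n ((x0 +i* y0) + L%:C) (0 +i* H)).
  apply: trap_Im_ge => t /tH/andP[t0 t1];
    rewrite imI ler_pM2l // ReV cabs_sqr !ReB !ImB !raddfD /=.
  rewrite !mulr0 !mul0r !addr0 subrr !addr0 -/a ler_pM2l // lef_pV2 ?posrE //.
    rewrite lerD2l -subr_ge0 subr_sqr; apply: mulr_ge0; lra.
  by rewrite ltr_pwDl ?sqr_ge0 ?exprn_gt0.
have h3 : Im (trap (fun y => (y - p)^-1) n ((x0 +i* y0) + (0 +i* H)) L%:C) <= 0.
  apply: trap_Im_le0 => t t01; rewrite imR mulr_ge0_le0 ?(ltW L0) // ImV mulr_le0_ge0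
    ?invr_ge0 ?sqr_ge0 //.
  rewrite oppr_le0 ImB !raddfD /= mul0r mulr0 !addr0; lra.
have h4 : Im (trap (fun y => (y - p)^-1) n (x0 +i* y0) (0 +i* H)) <= 0.
  apply: trap_Im_le0 => t /tH/andP[t0 t1];
    rewrite imI mulr_ge0_le0 ?(ltW H0) // ReV mulr_le0_ge0 ?invr_ge0 ?sqr_ge0 //.
  rewrite ReB !raddfD /= mul0r mulr0 !subr0 !addr0; lra.
lra.
Qed.
End MaxPrinciple.

(** * The maximum principle on a rectangle and the Schwarz-Pick lemma *)

Section SchwarzPick.
Local Open Scope complex_scope.
Context {R : realType}.
Implicit Types (p q z : R[i]).
Local Notation Re := complex.Re.
Local Notation Im := complex.Im.

Lemma cdiff_bounded_quotient (f : R[i] -> R[i]) p l : cdiff f p l ->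
  exists2 d : R, 0 < d & forall y, cabs (y - p) < d ->
    cabs (f y - f p) <= (cabs l + 1) * cabs (y - p).
Proof.
move=> /(_ 1 ltr01)[d d0 Hd]; exists d => // y /Hd h.
rewrite -(subrK (l * (y - p)) (f y - f p)).
apply: (le_trans (cabsD _ _)); rewrite cabsM; lra.
Qed.

(** Cauchy's estimate at [p] for every power of [f]: the quotient [F] has negligible contour sums,
    so the [n]-th power of [cabs (f p)] is at most a constant times [M ^+ n], with a constant
    independent of [n]. The point [q] allows for one bounded singularity. *)
Lemma max_rect (f : cplx R -> cplx R) p q (x0 y0 L H B M : R) : p != q ->
  x0 < Re p < x0 + L -> y0 < Im p < y0 + H -> 0 < M ->
  (forall y, inrect x0 y0 L H y -> cabs (f y) <= B) ->
  (forall y, inrect x0 y0 L H y -> y != q -> derivable f y 1) ->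
  (forall y, onrect x0 y0 L H y -> cabs (f y) <= M) ->
  cabs (f p) <= M.
Proof.
move=> pq px py M0 fB fd fM.
have [px0 px1] := andP px; have [py0 py1] := andP py.
have L0 : 0 < L by lra.
have H0 : 0 < H by lra.
have inp : inrect x0 y0 L H p by split; apply/andP; split; lra.
have [c0 c00 Hc0] := contour_kernel px py.
pose z0 := x0 +i* y0; pose u : R[i] := L%:C; pose v : R[i] := 0 +i* H.
have inR y : inpar z0 u v y -> inrect x0 y0 L H y.
  move=> [a [b [/andP[a0 a1] /andP[b0 b1] ->]]]; rewrite inpar_rect.
  have aL0 : 0 <= a * L by rewrite mulr_ge0 // ltW.
  have aL1 : a * L <= L by rewrite ler_piMl // ltW.
  have bH0 : 0 <= b * H by rewrite mulr_ge0 // ltW.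
  have bH1 : b * H <= H by rewrite ler_piMl // ltW.
  by split; apply/andP; split => /=; lra.
pose rho := Num.min (Num.min (Re p - x0) (x0 + L - Re p)) (Num.min (Im p - y0) (y0
  + H - Im p)).
have rho0 : 0 < rho by rewrite !lt_min !subr_gt0 px0 px1 py0 py1.
have kB y : onrect x0 y0 L H y -> cabs (y - p)^-1 <= rho^-1.
  move=> [_ Hy]; rewrite cabsV.
  have [r1 r2 r3 r4] : [/\ rho <= Re p - x0, rho <= x0 + L - Re p,
    rho <= Im p - y0 & rho <= y0 + H - Im p].
    by split; rewrite /rho !ge_min lexx ?orbT.
  suff h : rho <= cabs (y - p) by rewrite lef_pV2 ?posrE // (lt_le_trans rho0).
  have hr := Re_le_cabs (y - p); have hi := Im_le_cabs (y - p).
  have ha : - cabs (y - p) <= Re y - Re p <= cabs (y - p) by rewrite -ler_norml -ReB.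
  have hb : - cabs (y - p) <= Im y - Im p <= cabs (y - p) by rewrite -ler_norml -ImB.
  by case: Hy => e; [move: r1 e ha|move: r2 e ha|move: r3 e hb|move: r4 e hb]; clear; lra.
(* Here [rho^-1] bounds the kernel on the boundary, [2 * (cabs u + cabs v)] is the perimeter, and
   [c0] bounds the contour sum of the kernel from below. *)
apply: (@le_of_exprn_le _ _ _ (2 * rho^-1 * (cabs u + cabs v) / c0) M0) => n.
rewrite mulrAC ler_pdivlMr //.
apply/ler_addgt0Pr => c cpos.
pose F y := (f y ^+ n - f p ^+ n) * (y - p)^-1.
have derFn (y : cplx R) : derivable f y 1 -> derivable ((f : cplx R ->
  R[i]) ^+ n : cplx R -> cplx R) y 1.
  by move=> ?; apply: derivableX.
have fnE (y : R[i]) : ((f : cplx R -> R[i]) ^+ n) y = f y ^+ n by rewrite !fctE.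
have derF (y : cplx R) : derivable f y 1 -> y != p -> derivable (F : cplx R -> cplx R) y 1.
  move=> dy yp.
  have -> : (F : cplx R -> cplx R) =
     (((f : cplx R -> R[i]) ^+ n - cst (f p ^+ n)) * (fun y => (y - p)^-1)).
    by apply/funext => t; rewrite /F !fctE.
  apply: derivableM.
    apply: derivableB; [exact: derFn|exact: derivable_cst].
  apply: derivableV; first by rewrite subr_eq0.
  by apply: derivableB; [exact: derivable_id|exact: derivable_cst].
have [l Hl] : exists l, cdiff (fun y => f y ^+ n) p l.
  have [l Hl] := cdiffP (derFn _ (fd _ inp pq)); exists l.
  by move=> e /Hl[d d0 Hd]; exists d => // y /Hd; rewrite !fnE.
have [d d0 Hd] := cdiff_bounded_quotient Hl.
have [N HN] : contour_evle F z0 u v c.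
  (* Coordinates in the unit square: [F] can fail to be differentiable only at [p] and [q]. It is
     bounded near [p] as a difference quotient of [f ^+ n], and elsewhere because the denominator is
     at least [d]. *)
  pose par (y : R[i]) := ((Re y - x0) / L, (Im y - y0) / H).
  apply: (@goursat_exceptional _ _ _ _ _ [:: par p; par q]
    (Num.max (cabs l + 1) ((B ^+ n + B ^+ n) / d))) => //.
    move=> y /inR iny; rewrite /F cabsM cabsV le_max.
    have [yd|dy] := ltP (cabs (y - p)) d.
      apply/orP; left.
      have [->|yp] := eqVneq y p; first by rewrite !subrr cabs0 mul0r addr_ge0 ?cabs_ge0.
      rewrite ler_pdivrMr ?cabs_gt0 ?subr_eq0 //; exact: Hd.
    apply/orP; right; apply: ler_pM; rewrite ?invr_ge0 ?cabs_ge0 //.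
      apply: (le_trans (cabsD _ _)); rewrite cabsN !cabsX.
      by apply: lerD; rewrite lerXn2r ?nnegrE ?cabs_ge0 ?(le_trans (cabs_ge0 _) (fB _
        iny)) ?fB.
    by rewrite lef_pV2 ?posrE // (lt_le_trans d0).
  move=> a b a01 b01; rewrite !inE negb_or => /andP[abp abq].
  have iny := inR (z0 + a%:C * u + b%:C * v) (ex_intro _ a (ex_intro _ b (And3 a01 b01
    erefl))).
  have parE : (a, b) = par (z0 + a%:C * u + b%:C * v).
    rewrite inpar_rect /par /=; congr pair; field; exact: lt0r_neq0.
  apply: cdiffP; apply: derF; first apply: fd => //.
  - by apply: contraNneq abq => <-; rewrite parE.
  - by apply: contraNneq abp => <-; rewrite parE.
have {}HN := HN N (leqnn N).
pose K y := (y - p)^-1.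
have FE : contour F N z0 u v =
    contour (fun y => f y ^+ n * K y) N z0 u v + - (f p ^+ n) * contour K N z0 u v.
  rewrite -contourZ -contourD; apply: contour_ext => y; rewrite /F /K; ring.
have b1 : cabs (contour (fun y => f y ^+ n * K y) N z0 u v) <=
  2 * (M ^+ n * rho^-1) * (cabs u + cabs v).
  apply: contour_bound => y /(onpar_onrect L0 H0) ony.
  rewrite cabsM cabsX; apply: ler_pM; rewrite ?cabs_ge0 ?exprn_ge0 ?cabs_ge0 //.
    by rewrite lerXn2r ?nnegrE ?cabs_ge0 ?(ltW M0) ?fM.
  exact: kB.
have b2 : cabs (f p) ^+ n * c0 <= cabs (f p ^+ n * contour K N z0 u v).
  by rewrite cabsM cabsX ler_wpM2l ?exprn_ge0 ?cabs_ge0 // Hc0.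
apply: (le_trans b2).
have -> : f p ^+ n * contour K N z0 u v =
  contour (fun y => f y ^+ n * K y) N z0 u v - contour F N z0 u v by rewrite FE; ring.
apply: (le_trans (cabsD _ _)); rewrite cabsN lerD //.
apply: (le_trans b1); rewrite le_eqVlt; apply/orP; left; apply/eqP; ring.
Qed.

(** The pseudo-hyperbolic distance of the right half-plane; the denominator is the distance from [a]
    to the mirror image of [b] in the imaginary axis. *)
Definition pdist (a b : R[i]) : R := cabs (a - b) / cabs (a + b^*).

Lemma ReJ z : Re z^* = Re z. Proof. by case: z. Qed.

Lemma pdist_den_gt0 (a b : R[i]) : 0 < Re a -> 0 < Re b -> Re a + Re b <= cabs (a + b^*).
Proof.
move=> a0 b0; have := Re_le_cabs (a + b^*); rewrite raddfD /= ReJ.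
by rewrite ger0_norm // addr_ge0 // ltW.
Qed.

(** This expresses [1 - pdist a b ^+ 2] as [4 * Re a * Re b] over the squared denominator. *)
Lemma cabs_addJ_sqr (a b : R[i]) : cabs (a + b^*) ^+ 2 =
  cabs (a - b) ^+ 2 + 4 * (Re a * Re b).
Proof. by rewrite !cabs_sqr; case: a => a1 a2; case: b => b1 b2 /=; ring. Qed.

Lemma pdist_le1 (a b : R[i]) : 0 < Re a -> 0 < Re b -> pdist a b <= 1.
Proof.
move=> a0 b0; have h := pdist_den_gt0 a0 b0.
rewrite /pdist ler_pdivrMr ?mul1r; last by apply: lt_le_trans h; rewrite addr_gt0.
rewrite -(@ler_pXn2r _ 2) ?nnegrE ?cabs_ge0 //.
by rewrite cabs_addJ_sqr lerDl !mulr_ge0 // ltW.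
Qed.

(** By [cabs_addJ_sqr] this makes [pdist z q] close to 1 on the boundary. On the left side [Re z] is
    only [ep]; on the other three [Re z <= N] while [cabs (z - q) >= N / 2], so the right-hand side
    wins quadratically. The factors 16 are what these two cases require. *)
Lemma rect_boundary_far q z (eta ep N : R) : 0 < Re q -> 0 < eta -> 0 < ep ->
  ep <= eta * Re q / 16 -> ep <= Re q / 2 ->
  16 * Re q <= N * eta -> 2 * Re q <= N -> 2 * `|Im q| <= N ->
  onrect ep (- N) (N - ep) (2 * N) z ->
  4 * (Re z * Re q) <= eta * cabs (z - q) ^+ 2.
Proof.
move=> q0 eta0 ep0 ep1 ep2 Neta NRq NIq [[/andP[z1 z2] /andP[z3 z4]] Hz].
have hr := Re_le_cabs (z - q); have hi := Im_le_cabs (z - q).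
move: hr hi; rewrite ReB ImB !ler_norml => /andP[r1 r2] /andP[i1 i2].
have lq := ler_norm (Im q); have lq' := ler_norm (- Im q); rewrite normrN in lq'.
have sq (m : R) : 0 <= m -> m <= cabs (z - q) -> m ^+ 2 <= cabs (z - q) ^+ 2.
  by move=> m0 mz; rewrite lerXn2r ?nnegrE // cabs_ge0.
have [Hleft|Hfar] : (Re z = ep) \/ (N / 2 <= cabs (z - q)).
- case: Hz => e; [by left|right|right|right].
  + by move: e r1 r2 NRq; clear; lra.
  + by move: e i1 i2 lq lq' NIq; clear; lra.
  + by move: e i1 i2 lq lq' NIq; clear; lra.
- have hs : (Re q / 2) ^+ 2 <= cabs (z - q) ^+ 2.
    by apply: sq; [rewrite divr_ge0 // ltW|move: Hleft ep2 r1; clear; lra].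
  apply: le_trans (ler_wpM2l (ltW eta0) hs).
  have := ler_wpM2r (ltW q0) ep1; rewrite Hleft; clear; lra.
- have N0 : 0 <= N by move: NRq q0; clear; lra.
  have hs := sq (N / 2) (divr_ge0 N0 (ler0n _ 2)) Hfar.
  apply: le_trans (ler_wpM2l (ltW eta0) hs).
  have zN : Re z <= N by move: z2; clear; lra.
  have := ler_wpM2r (ltW q0) zN; have := ler_wpM2l N0 Neta; clear; lra.
Qed.

(** The maximum principle for a quotient [h] of two Blaschke factors, of modulus
    [pdist (F z) (F q) / pdist z q] off [q]. It is bounded, differentiable off [q], and at most
    [1 + eta] on the boundary of a large rectangle, where the numerator is at most 1 and the
    denominator almost 1. *)
Lemma schwarz_pick (F : cplx R -> cplx R) p q :
  Hol (halfplane R) (halfplane R) F -> 0 < Re p -> 0 < Re q ->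
  pdist (F p) (F q) <= pdist p q.
Proof.
move=> [Fd FH] p0 q0.
have [->|pq] := eqVneq p q; first by rewrite /pdist !subrr cabs0 !mul0r.
have Fp0 : 0 < Re (F p) by exact: FH.
have Fq0 : 0 < Re (F q) by exact: FH.
(* Since the inverse of 0 is 0, [h q = 0]; this value is arbitrary, and [q] is the exceptional point
   of [max_rect]. *)
pose h (z : cplx R) : cplx R := ((F z - F q) * (F z + (F q)^*)^-1) * ((z
  + q^*) * (z - q)^-1) : R[i].
have hE z : cabs (h z) = pdist (F z) (F q) * (cabs (z + q^*) / cabs (z - q)).
  by rewrite /h !cabsM !cabsV.
have nz (a b : R[i]) : 0 < Re a -> 0 < Re b -> a + b^* != 0.
  by move=> a0 b0; rewrite -cabs_gt0; apply: lt_le_trans (pdist_den_gt0 a0 b0);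
    rewrite addr_gt0.
have [l Hl] := cdiffP (Fd q q0).
have [d d0 Hd] := cdiff_bounded_quotient Hl.
have addJ z : z + q^* = (z - q) + (2 * Re q)%:C.
  by case: (z) => a b; case: (q) => a' b'; apply/eqP; rewrite eq_complex /=; apply/andP;
    split; apply/eqP; ring.
have hB z : 0 < Re z -> cabs (h z) <=
    Num.max ((cabs l + 1) / Re (F q) * (d + 2 * Re q)) (1 + 2 * Re q / d).
  move=> z0; have Fz0 : 0 < Re (F z) by exact: FH.
  have le2 : cabs (z + q^*) <= cabs (z - q) + 2 * Re q.
    by rewrite addJ; apply: (le_trans (cabsD _ _));
      rewrite cabs_real ger0_norm // mulr_ge0 // ltW.
  rewrite hE le_max; have [zd|dz] := ltP (cabs (z - q)) d; apply/orP; [left|right].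
    have [->|zq] := eqVneq z q.
      rewrite subrr cabs0 invr0 !mulr0 mulr_ge0 ?addr_ge0 ?mulr_ge0 ?addr_ge0 ?cabs_ge0
        ?invr_ge0 //; exact: ltW.
    have zq0 : 0 < cabs (z - q) by rewrite cabs_gt0 subr_eq0.
    have den : Re (F q) <= cabs (F z + (F q)^*).
      by apply: le_trans (pdist_den_gt0 Fz0 Fq0); rewrite lerDr ltW.
    have := Hd _ zd => hh.
    have -> : pdist (F z) (F q) * (cabs (z + q^*) / cabs (z - q)) =
      (cabs (F z - F q) / cabs (z - q)) / cabs (F z + (F q)^*) * cabs (z + q^*).
      by rewrite /pdist; ring.
    apply: ler_pM; rewrite ?cabs_ge0 //.
    - by rewrite !mulr_ge0 ?invr_ge0 ?cabs_ge0.
    - apply: ler_pM; rewrite ?invr_ge0 ?cabs_ge0 ?mulr_ge0 ?invr_ge0 ?cabs_ge0 //.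
        by rewrite ler_pdivrMr.
      by rewrite lef_pV2 ?posrE // (lt_le_trans Fq0).
    - lra.
  have zq0 := lt_le_trans d0 dz.
  rewrite -[leRHS]mul1r; apply: ler_pM; rewrite ?pdist_le1 ?mulr_ge0 ?divr_ge0 ?invr_ge0
    ?cabs_ge0 //.
  apply: (@le_trans _ _ ((cabs (z - q) + 2 * Re q) / cabs (z - q))).
    by rewrite ler_pM2r ?invr_gt0.
  rewrite mulrDl divff ?gt_eqF // lerD2l ler_pM2l ?mulr_gt0 //.
  by rewrite lef_pV2 ?posrE.
suff : cabs (h p) <= 1.
  rewrite hE [X in _ -> _ <= X]/pdist => hle.
  have den : 0 < cabs (p + q^*) by rewrite cabs_gt0 nz.
  have num : 0 < cabs (p - q) by rewrite cabs_gt0 subr_eq0.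
  have -> : pdist (F p) (F q) = pdist (F p) (F q) * (cabs (p
    + q^*) / cabs (p - q)) * (cabs (p - q) / cabs (p + q^*)).
    by field; rewrite !gt_eqF.
  by rewrite ler_piMl // divr_ge0 ?cabs_ge0.
apply/ler_addgt0Pr => eta eta0.
pose ep := Num.min (eta * Re q / 16) (Num.min (Re q / 2) (Re p / 2)).
have ep0 : 0 < ep by rewrite !lt_min; apply/and3P; split; rewrite ?divr_gt0 ?mulr_gt0.
have [ep1 ep2 ep3] : [/\ ep <= eta * Re q / 16, ep <= Re q / 2 & ep <= Re p / 2].
  by split; rewrite /ep !ge_min lexx ?orbT.
pose N := 16 * Re q / eta + 2 * Re q + 2 * `|Im q| + Re p + `|Im p| + 1.
have N1 : 0 < 16 * Re q / eta by rewrite divr_gt0 // mulr_gt0.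
have nq := normr_ge0 (Im q); have np := normr_ge0 (Im p).
have lq := ler_norm (Im q); have lq' := ler_norm (- Im q); rewrite normrN in lq'.
have lp := ler_norm (Im p); have lp' := ler_norm (- Im p); rewrite normrN in lp'.
have Neta : 16 * Re q <= N * eta.
  by rewrite -ler_pdivrMr // /N; move: q0 p0 nq np; clear; lra.
have NIq : 2 * `|Im q| <= N by rewrite /N; move: q0 p0 nq np N1; clear; lra.
have NRq : 2 * Re q <= N by rewrite /N; move: q0 p0 nq np N1; clear; lra.
have NRp : Re p + 1 <= N by rewrite /N; move: q0 p0 nq np N1; clear; lra.
have NIp : `|Im p| + 1 <= N by rewrite /N; move: q0 p0 nq np N1; clear; lra.
move: N Neta NIq NRq NRp NIp => N Neta NIq NRq NRp NIp.
apply: (@max_rect h p q ep (- N) (N - ep) (2 * N) _ (1 + eta) pq); last first.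
- move=> z onz.
  have z0 : 0 < Re z by have [[/andP[z1 _] _] _] := onz; exact: lt_le_trans z1.
  have Fz0 : 0 < Re (F z) by exact: FH.
  have [zq|zq] := eqVneq z q.
    by rewrite /h zq !subrr mul0r mul0r cabs0 addr_ge0 // ltW.
  have zq0 : 0 < cabs (z - q) by rewrite cabs_gt0 subr_eq0.
  have key := rect_boundary_far q0 eta0 ep0 ep1 ep2 Neta NRq NIq onz.
  rewrite hE -[leRHS]mul1r; apply: ler_pM;
    rewrite ?pdist_le1 ?mulr_ge0 ?divr_ge0 ?invr_ge0 ?cabs_ge0 //.
  rewrite ler_pdivrMr // -(@ler_pXn2r _ 2) ?nnegrE ?cabs_ge0 ?mulr_ge0 ?cabs_ge0 //;
    last by rewrite addr_ge0 // ltW.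
  rewrite cabs_addJ_sqr exprMn.
  have : 0 <= (eta + eta ^+ 2) * cabs (z - q) ^+ 2.
    by rewrite mulr_ge0 ?sqr_ge0 // addr_ge0 ?sqr_ge0 // ltW.
  by move: key; clear; lra.
- move=> z [/andP[z1 z2] _] zq.
  have z0 : 0 < Re z by exact: lt_le_trans z1.
  have -> : h = (((F : cplx R -> R[i]) - cst (F q)) * (fun z => (F z + (F q)^*)^-1)) *
      ((id + cst (q^*)) * (fun z => (z - q)^-1)) :> (cplx R -> cplx R).
    by apply/funext => t.
  apply: derivableM; apply: derivableM.
  - by apply: derivableB; [exact: Fd|exact: derivable_cst].
  - apply: derivableV; first by apply: nz => //; exact: FH.
    by apply: derivableD; [exact: Fd|exact: derivable_cst].
  - by apply: derivableD; [exact: derivable_id|exact: derivable_cst].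
  - apply: derivableV; first by rewrite subr_eq0.
    by apply: derivableB; [exact: derivable_id|exact: derivable_cst].
- by move=> z [/andP[z1 z2] _]; apply: hB; exact: lt_le_trans z1.
- by rewrite addr_gt0.
- by move: NIp lp lp'; clear => *; apply/andP; split; lra.
- by move: p0 ep0 ep3 NRp; clear => *; apply/andP; split; lra.
Qed.
End SchwarzPick.

(** * Bernstein functions *)

Section Bernstein.
Context {R : realType}.
Implicit Types (f g h k : R -> R) (x y a b : R) (n : nat).

(* [(-1) ^ k f^(k) >= 0] on [(0, +oo)] for [k <= n]; the derivatives are witnesses,
   so that the values of [f] outside [(0, +oo)] are irrelevant. *)
Fixpoint cm_upto n f : Prop :=
  (forall x, 0 < x -> 0 <= f x) /\
  if n is n'.+1 then
    exists2 g, forall x, 0 < x -> is_derive x 1 f (- g x) & cm_upto n' g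
  else True.

Definition CM f := forall n, cm_upto n f.

Lemma cm_upto_ge0 n f x : cm_upto n f -> 0 < x -> 0 <= f x.
Proof. by case: n => [|n] [+ _]; apply. Qed.

Lemma near_pos x : 0 < x -> \forall y \near x, 0 < y.
Proof. by move=> x0; exact: lt_nbhsr. Qed.

Lemma is_derive_ext f g x l : (forall y, 0 < y -> f y = g y) -> 0 < x ->
  is_derive x (1 : R) f l -> is_derive x (1 : R) g l.
Proof.
move=> fg x0; apply: near_eq_is_derive.
by near=> y; apply: fg; near: y; exact: near_pos.
Unshelve. all: by end_near. Qed.

Lemma cm_upto_ext n f g : (forall y, 0 < y -> f y = g y) -> cm_upto n f -> cm_upto n g.
Proof.
move=> fg; case: n => [|n] [f0 H]; split; try by move=> x x0; rewrite -fg ?f0.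
  by [].
have [f' df cf'] := H; exists f' => // x x0.
by apply: is_derive_ext (df x x0).
Qed.

Lemma cm_uptoW n f : cm_upto n.+1 f -> cm_upto n f.
Proof.
elim: n f => [|n IH] f [f0 [f' df cf']]; split=> //.
by exists f' => //; exact: IH.
Qed.

Lemma cm_uptoD n f g : cm_upto n f -> cm_upto n g -> cm_upto n (fun x => f x + g x).
Proof.
elim: n f g => [|n IH] f g [f0 Hf] [g0 Hg]; split; try by move=> x x0;
  rewrite addr_ge0 ?f0 ?g0.
  by [].
have [f' df cf'] := Hf; have [g' dg cg'] := Hg.
exists (fun x => f' x + g' x); last exact: IH.
by move=> x x0; rewrite opprD; apply: is_deriveD; auto.
Qed.

Lemma cm_uptoM n f g : cm_upto n f -> cm_upto n g -> cm_upto n (fun x => f x * g x).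
Proof.
elim: n f g => [|n IH] f g Hf Hg; (split; first by move=> x x0;
  rewrite mulr_ge0 ?(cm_upto_ge0 Hf) ?(cm_upto_ge0 Hg)) => //.
have cf := cm_uptoW Hf; have cg := cm_uptoW Hg.
have [_ [f' df cf']] := Hf; have [_ [g' dg cg']] := Hg.
exists (fun x => f' x * g x + f x * g' x); last by apply: cm_uptoD; apply: IH.
move=> x x0; have := @is_deriveM _ _ f g x 1 _ _ (df x x0) (dg x x0).
by move=> hd; apply: (is_derive_eq hd); rewrite /GRing.scale /=; ring.
Qed.

(** By the chain rule, minus the derivative of the composition is the product of minus the
    derivative of [f], taken at [g], with [g']; both factors are covered at one order less. *)
Lemma cm_upto_comp n f g g' : (forall x, 0 < x -> 0 < g x) ->
  (forall x, 0 < x -> is_derive x 1 g (g' x)) ->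
  cm_upto n g' -> cm_upto n f -> cm_upto n (fun x => f (g x)).
Proof.
move=> g0 dg; elim: n f => [|n IH] f cg' Hf;
  (split; first by move=> x x0; rewrite (cm_upto_ge0 Hf) ?g0) => //.
have [_ [f' df cf']] := Hf.
exists (fun x => f' (g x) * g' x).
  move=> x x0; have := @is_derive1_comp _ f g x _ _ (df _ (g0 _ x0)) (dg _ x0).
  by move=> hd; apply: (is_derive_eq hd); rewrite mulNr.
by apply: cm_uptoM; [apply: IH => //; exact: cm_uptoW|exact: cm_uptoW].
Qed.

Lemma derive1_val f x l : is_derive x (1 : R) f l -> (derive1 f) x = l.
Proof. by move=> df; rewrite derive1E derive_val. Qed.

Lemma CM_derive f : CM f -> (forall x, 0 < x -> is_derive x (1 : R) f ((derive1 f) x)) /\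
  CM (fun x => - (derive1 f) x).
Proof.
move=> cf; split.
  move=> x x0; have [_ [f' df _]] := cf 1%N.
  by rewrite (derive1_val (df x x0)); exact: df.
move=> n; have [_ [f' df cf']] := cf n.+1; apply: cm_upto_ext cf' => y y0.
by rewrite (derive1_val (df y y0)) opprK.
Qed.

Lemma bernstein_CM g : bernstein g -> [/\ forall x, 0 < x -> 0 <= g x,
  forall x, 0 < x -> is_derive x (1 : R) g ((derive1 g) x) & CM (derive1 g)].
Proof.
move=> [g0 dg sg].
have dnE n x : 0 < x -> is_derive x (1 : R) (derive1n n g) (derive1n n.+1 g x).
  by move=> x0; rewrite derive1nS derive1E; apply/derivableP/dg.
split; [exact: g0|exact: (dnE 0%N)|].
suff H n m : cm_upto n (fun x => (-1) ^+ m * derive1n m.+1 g x).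
  by move=> n; apply: cm_upto_ext (H n 0%N) => y y0; rewrite expr0 mul1r.
elim: n m => [|n IH] m; split=> //; try by
  move=> x x0; have := sg m.+1 x isT x0; rewrite !exprS !mulN1r opprK.
exists (fun x => (-1) ^+ m.+1 * derive1n m.+2 g x) => [x x0|]; last exact: IH.
have := @is_deriveZ _ _ _ (derive1n m.+1 g) ((-1) ^+ m) x 1 _ (dnE m.+1 x x0).
by move=> hd; apply: (is_derive_eq hd); rewrite exprS mulN1r mulNr opprK.
Qed.

Lemma CM_derive1n f n : CM f -> forall x, 0 < x ->
  derivable (derive1n n f) x 1 /\ 0 <= (-1) ^+ n * derive1n n f x.
Proof.
move=> cf.
have key m : forall g, CM g -> forall x, 0 < x -> (derivable (derive1n m g) x 1) /\
  CM (fun x => (-1) ^+ m * derive1n m g x).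
  elim: m => [|m IH] g' cg x x0.
    split; first by have [h _] := CM_derive cg; have := h x x0; case.
    by move=> n'; apply: cm_upto_ext (cg n') => y _; rewrite expr0 mul1r.
  have [_ cm] := IH g' cg x x0.
  have [dm cm'] := CM_derive cm.
  have dmE y : 0 < y -> (derive1 (fun x => (-1) ^+ m * derive1n m g' x)) y =
    (-1) ^+ m * derive1n m.+1 g' y.
    move=> y0; have [dy _] := IH g' cg y y0.
    rewrite derive1E derive1nS derive1E.
    have := @is_deriveZ _ _ _ (derive1n m g') ((-1) ^+ m) y 1 _ (derivableP dy).
    by move=> h; rewrite derive_val.
  have cm2 : CM (fun x => (-1) ^+ m.+1 * derive1n m.+1 g' x).
    by move=> n'; apply: cm_upto_ext (cm' n') => y y0; rewrite dmE // exprS mulN1r mulNr.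
  split=> //; have [d2 _] := CM_derive cm2.
  have [d2x _] := d2 x x0.
  have : derivable ((-1) ^+ m.+1 \*: (fun x => (-1) ^+ m.+1 * derive1n m.+1 g' x)) x 1.
    exact: derivableZ.
  rewrite (_ : _ \*: _ = derive1n m.+1 g') //; apply/funext => t.
  rewrite -[LHS]/((-1) ^+ m.+1 * ((-1) ^+ m.+1 * derive1n m.+1 g' t)).
  by rewrite mulrA -expr2 sqrr_sign mul1r.
move=> x x0; have [d cm] := key n f cf x x0; split=> //.
exact: cm_upto_ge0 (cm 0%N) x0.
Qed.

Lemma CM_bernstein g : (forall x, 0 < x -> 0 <= g x) ->
  (forall x, 0 < x -> derivable g x 1) -> CM (derive1 g) -> bernstein g.
Proof.
move=> g0 dg cg; split; first exact: g0.
  move=> [|n] x x0; first exact: dg.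
  by rewrite derive1Sn; case: (CM_derive1n n cg x0).
move=> [//|n] x _ x0; rewrite derive1Sn !exprS mulN1r mulN1r opprK.
by case: (CM_derive1n n cg x0).
Qed.

Lemma bernstein_comp f g : bernstein f -> bernstein g ->
  (forall x, 0 < x -> 0 < g x) -> bernstein (fun x => f (g x)).
Proof.
move=> /bernstein_CM[f0 df cf] /bernstein_CM[_ dg cg] g0.
have dfg x : 0 < x -> is_derive x (1 : R) (fun x =>
  f (g x)) ((derive1 f) (g x) * (derive1 g) x).
  by move=> x0; apply: (@is_derive1_comp _ f g); [exact: df (g0 _ x0)|exact: dg].
apply: CM_bernstein => [x x0|x /dfg[]//|n]; first exact: f0 (g0 _ x0).
have : cm_upto n (fun x => (derive1 f) (g x) * (derive1 g) x).
  by apply: cm_uptoM; [exact: cm_upto_comp g0 dg (cg n) (cf n)|exact: cg].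
by apply: cm_upto_ext => y y0; rewrite (derive1_val (dfg y y0)).
Qed.

Lemma bernstein_id : bernstein (fun x : R => x).
Proof.
have c0 n : cm_upto n (fun _ : R => 0).
  elim: n => [|n IH]; split=> //; exists (fun _ => 0) => // x _.
  by rewrite oppr0; exact: is_derive_cst.
have d1 : (derive1 (fun x : R => x)) = fun _ => 1.
  by apply/funext => x; rewrite derive1E derive_id.
apply: CM_bernstein => [x /ltW//|x _|n]; first exact: derivable_id.
rewrite d1; case: n => [|n]; split=> //; exists (fun _ => 0) => // x _.
by rewrite oppr0; exact: is_derive_cst.
Qed.
End Bernstein.

(** * Pointwise limits of completely monotone and of Bernstein functions *)

Section BernsteinLimits.
Context {R : realType}.
Implicit Types (f g k df : R -> R) (x y z a b h e : R) (s : seq R) (n : nat).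

Lemma mvt_pos f df a x y : 0 < a -> a <= x -> a <= y ->
  (forall z, 0 < z -> is_derive z (1 : R) f (df z)) ->
  exists c, [/\ a <= c, `|c - x| <= `|y - x|, Num.min x y <= c <= Num.max x y
    & f y - f x = df c * (y - x)].
Proof.
move=> a0; wlog xy : x y / x <= y => [H|ax ay fd].
  move=> ax ay fd; case/orP: (le_total x y) => [xy|yx]; first exact: (H x y xy ax ay fd).
  have [c [ac cy cc E]] := H y x yx ay ax fd; exists c; split=> //; last first.
  - by rewrite -opprB E; ring.
  - by rewrite minC maxC.
  move: cc; rewrite (min_idPl yx) (max_idPr yx) => /andP[c1 c2].
  rewrite !ler0_norm; lra.
have x0 : 0 < x by lra.
have [||c' cxy E] := @MVT_segment _ f df x y xy.
- move=> c; rewrite inE /= => /andP[xc _]; apply: fd; move: xc; rewrite ?bnd_simp; lra.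
- apply: derivable_within_continuous => z; rewrite in_itv /= => /andP[xz _].
  by have [] := fd z (lt_le_trans x0 xz).
move: cxy; rewrite in_itv /= => /andP[c1 c2]; exists c'; split=> //.
- lra.
- by rewrite !ger0_norm; lra.
- by rewrite (min_idPl xy) (max_idPr xy) c1 c2.
Qed.

Lemma taylor_bound f df ddf a M x y : 0 < a -> a <= x -> a <= y ->
  (forall z, 0 < z -> is_derive z (1 : R) f (df z)) ->
  (forall z, 0 < z -> is_derive z (1 : R) df (ddf z)) ->
  (forall z, a <= z -> `|ddf z| <= M) ->
  `|f y - f x - df x * (y - x)| <= M * (y - x) ^+ 2.
Proof.
move=> a0 ax ay d1 d2 Mb.
have [c [ac cx _ ->]] := mvt_pos a0 ax ay d1.
have [c' [ac' _ _]] := mvt_pos a0 ax ac d2.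
rewrite -mulrBl => ->; rewrite !normrM -[in leRHS]real_normK ?num_real //.
rewrite -mulrA expr2 ; apply: ler_pM; rewrite ?mulr_ge0 //; first exact: Mb.
by rewrite ler_wpM2r.
Qed.

Lemma CM_nonincr f x y : CM f -> 0 < x -> x <= y -> f y <= f x.
Proof.
move=> cf x0 xy; have [df cf'] := CM_derive cf.
have [c [xc _ _ E]] := mvt_pos x0 (lexx x) xy df.
have : 0 <= - derive1 f c by apply: cm_upto_ge0 (cf' 0%N) _; lra.
by move=> h; rewrite -subr_le0 E mulr_le0_ge0 ?subr_ge0 //; lra.
Qed.

(** The function [- derive1 f] is nonincreasing, so its value at [a] is at most its mean over
    [a/2, a], which is at most [f (a / 2)] divided by [a / 2]. *)
Lemma CM_derive_bound f a x : CM f -> 0 < a -> a <= x ->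
  0 <= - derive1 f x <= 2 * f (a / 2) / a.
Proof.
move=> cf a0 ax; have [df cf'] := CM_derive cf.
have x0 : 0 < x by lra.
rewrite (cm_upto_ge0 (cf' 0%N) x0) /=.
apply: (le_trans (CM_nonincr cf' a0 ax)).
have a20 : 0 < a / 2 by lra.
have [c [ac _ cc E]] := mvt_pos a20 (lexx (a / 2)) (ltac:(lra) : a / 2 <= a) df.
have ca : c <= a by move: cc => /andP[_]; rewrite (max_idPr _) //; lra.
have := CM_nonincr cf' (lt_le_trans a20 ac) ca.
have fa := cm_upto_ge0 (cf 0%N) a0.
rewrite ler_pdivlMr // => h.
have : - derive1 f c * (a - a / 2) = f (a / 2) - f a by rewrite mulNr -E; ring.
have := ler_wpM2r (ltW a0) h.
lra.
Qed.

(** Two uses of [CM_derive_bound], from [a] to [a / 2] and from there to [a / 4], bound the second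
    derivative by a value of [f]; this produces the 8. *)
Lemma CM_taylor f a x y : CM f -> 0 < a -> a <= x -> a <= y ->
  `|f y - f x - derive1 f x * (y - x)| <= 8 / a ^+ 2 * f (a / 4) * (y - x) ^+ 2.
Proof.
move=> cf a0 ax ay; have [df cf'] := CM_derive cf.
have [df' cf''] := CM_derive cf'.
pose f1 x := - derive1 f x.
have d2 z : 0 < z -> is_derive z (1 : R) (derive1 f) (- derive1 f1 z).
  move=> z0; have := is_deriveN (df' z z0).
  by rewrite (_ : - _ = derive1 f) //; apply/funext => t; rewrite fctE opprK.
apply: (taylor_bound a0 ax ay df d2) => z z0.
have /andP[h1 h2] := CM_derive_bound cf' a0 z0.
rewrite ger0_norm //; apply: (le_trans h2).
have a20 : 0 < a / 2 by lra.
have /andP[_] := CM_derive_bound cf a20 (lexx _).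
rewrite (_ : a / 2 / 2 = a / 4); last by field.
move=> h3; rewrite ler_pdivrMr //.
have -> : 8 / a ^+ 2 * f (a / 4) * a = 2 * (2 * f (a / 4) / (a / 2)) by field;
  rewrite gt_eqF.
lra.
Qed.

(** One use of [CM_derive_bound] for the derivative; its value at [a / 2] is at most its mean over
    [a/4, a/2], hence at most [4 * f (a / 2) / a]. *)
Lemma bernstein_taylor f a x y : bernstein f -> 0 < a -> a <= x -> a <= y ->
  `|f y - f x - derive1 f x * (y - x)| <= 8 / a ^+ 2 * f (a / 2) * (y - x) ^+ 2.
Proof.
move=> /bernstein_CM[f0 df cf] a0 ax ay.
have [df' cf'] := CM_derive cf.
apply: (taylor_bound a0 ax ay df df') => z za.
have /andP[h1 h2] := CM_derive_bound cf a0 za.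
rewrite ler0_norm -?oppr_ge0 //; apply: (le_trans h2).
have a40 : 0 < a / 4 by lra.
have [c [ac _ cc E]] := mvt_pos a40 (lexx (a / 4)) (ltac:(lra) : a / 4 <= a / 2) df.
have ca : c <= a / 2 by move: cc => /andP[_]; rewrite (max_idPr _) //; lra.
have h := CM_nonincr cf (lt_le_trans a40 ac) ca.
have f4 := f0 _ a40.
have h3 : derive1 f (a / 2) * a <= 4 * f (a / 2).
  have := ler_wpM2r (ltW a40) h.
  have : a / 2 - a / 4 = a / 4 by field.
  move=> e; rewrite e in E; lra.
rewrite ler_pdivrMr //.
have -> : 8 / a ^+ 2 * f (a / 2) * a = 2 * (4 * f (a / 2) / a) by field; rewrite gt_eqF.
by rewrite ler_pM2l // ler_pdivlMr.
Qed.

(** The closure of [S] in the topology of pointwise convergence on (0, +oo). *)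
Definition approx (S : set (R -> R)) k := forall (s : seq R) (e : R),
  (forall x, x \in s -> 0 < x) -> 0 < e ->
  exists2 f, S f & forall x, x \in s -> `|k x - f x| < e.

Lemma approx_ge0 (S : set (R -> R)) k x : approx S k ->
  (forall f, S f -> 0 <= f x) -> 0 < x -> 0 <= k x.
Proof.
move=> Sk S0 x0; rewrite leNgt; apply/negP => kx.
have [||f Sf] := Sk [:: x] (- k x); first by move=> y; rewrite inE => /eqP ->.
  by rewrite oppr_gt0.
move=> /(_ x (mem_head _ _)); rewrite ltr_norml => /andP[h _].
have := S0 _ Sf; lra.
Qed.

Lemma seq_lb (s : seq R) : (forall x, x \in s -> 0 < x) ->
  exists2 a : R, 0 < a & forall x, x \in s -> a <= x.
Proof.
elim: s => [_|x s IH H]; first by exists 1.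
have [|a a0 ha] := IH; first by move=> y ys; apply: H; rewrite inE ys orbT.
have x0 : 0 < x by apply: H; rewrite mem_head.
exists (Num.min x a) => [|y]; first by rewrite lt_min x0.
by rewrite inE ge_min => /orP[/eqP -> |/ha ->]; rewrite ?lexx ?orbT.
Qed.

(** The second-order constant of [f] depends on [f] only through [f b], so approximating [k] at [b]
    as well makes it uniform. Difference quotients of [k] then form a Cauchy family as the step
    tends to 0, and the derivatives of [k] and of [f] are compared through a quotient with one fixed
    step. *)
Lemma approx_derive (S : set (R -> R)) k :
  (forall a, 0 < a -> exists b C, [/\ 0 < b, 0 <= C & forall f x y, S f -> a <= x ->
    a <= y ->
    `|f y - f x - derive1 f x * (y - x)| <= C * f b * (y - x) ^+ 2]) ->
  approx S k ->
  (forall x, 0 < x -> derivable k x 1) /\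
  approx [set derive1 f | f in S] (derive1 k).
Proof.
move=> taylor Sk.
pose E x h := h^-1 * (k (x + h) - k x).
(* Precision at most 1 at the extra point [b] gives [f b <= |k b| + 1], which bounds the constant by
   [M] for all approximants used. *)
have bnd a : 0 < a -> exists2 M, 0 < M & forall s e, (forall x, x \in s -> a <= x) ->
  0 < e ->
    exists2 f, S f & (forall x, x \in s -> `|k x - f x| < e) /\
     forall x y, a <= x -> a <= y -> `|f y - f x - derive1 f x * (y - x)| <=
       M * (y - x) ^+ 2.
  move=> a0; have [b [C [b0 C0 tay]]] := taylor a a0.
  exists (C * (`|k b| + 1) + 1) => [|s e sa e0].
    by rewrite ltr_wpDl // mulr_ge0 // addr_ge0.
  have [||f Sf Hf] := Sk (b :: s) (Num.min e 1).
  - by move=> x; rewrite inE => /orP[/eqP -> //|/sa]; exact: lt_le_trans.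
  - by rewrite lt_min e0 ltr01.
  exists f => //; split.
    by move=> x xs; have := Hf x; rewrite inE xs orbT lt_min => /(_ isT)/andP[].
  move=> x y ax ay; apply: (le_trans (tay f x y Sf ax ay)).
  rewrite ler_wpM2r ?sqr_ge0 //.
  have := Hf b (mem_head _ _); rewrite lt_min => /andP[_].
  rewrite distrC => h; have h2 := le_trans (ler_norm _) (ltW h).
  have h3 := ler_norm (k b).
  have : C * f b <= C * (`|k b| + 1) by rewrite ler_wpM2l //; lra.
  lra.
have E1 f a M x h : (forall x y, a <= x -> a <= y ->
  `|f y - f x - derive1 f x * (y - x)| <= M * (y - x) ^+ 2) ->
    h != 0 -> a <= x -> a <= x + h ->
    `|E x h - derive1 f x| <= M * `|h| + (`|k (x + h) - f (x + h)| + `|k x - f x|) / `|h|.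
  move=> tay h0 ax axh; have := tay x (x + h) ax axh.
  have -> : x + h - x = h by ring.
  move=> t; have hn : 0 < `|h| by rewrite normr_gt0.
  have -> : E x h - derive1 f x = h^-1 * ((f (x + h) - f x - derive1 f x * h)
     + ((k (x + h) - f (x + h)) - (k x - f x))) by rewrite /E; field.
  rewrite normrM normfV mulrC ler_pdivrMr // mulrDl divfK ?gt_eqF //.
  apply: (le_trans (ler_normD _ _)); apply: lerD; last exact: ler_normB.
  by rewrite -mulrA -expr2 real_normK ?num_real.
have Ecauchy a : 0 < a -> exists2 M, 0 < M & forall x h h', a <= x -> a <= x + h ->
  a <= x + h' ->
    h != 0 -> h' != 0 -> `|E x h - E x h'| <= M * (`|h| + `|h'|).
  move=> a0; have [M M0 HM] := bnd a a0; exists M => // x h h' ax ah ah' h0 h'0.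
  apply/ler_addgt0Pr => e e0.
  have hn : 0 < `|h| by rewrite normr_gt0.
  have hn' : 0 < `|h'| by rewrite normr_gt0.
  pose m := Num.min `|h| `|h'|.
  have m0 : 0 < m by rewrite lt_min hn hn'.
  (* The approximation error is divided by a step of modulus at least [m], hence the factor [m] in
     the precision. *)
  have [||f Sf [Hf tay]] := HM [:: x; x + h; x + h'] (e * m / 4).
  - by move=> y; rewrite !inE => /or3P[] /eqP ->.
  - by rewrite divr_gt0 // mulr_gt0.
  have f1 := Hf x; have f2 := Hf (x + h); have f3 := Hf (x + h').
  rewrite !inE !eqxx ?orbT in f1 f2 f3.
  have {}f1 := f1 isT; have {}f2 := f2 isT; have {}f3 := f3 isT.
  have e1 := E1 f a M x h tay h0 ax ah; have e2 := E1 f a M x h' tay h'0 ax ah'.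
  have small (t u v : R) : 0 < t -> m <= t -> u < e * m / 4 -> v < e * m / 4 ->
    (u + v) / t <= e / 2.
    move=> t0 mt u1 v1; rewrite ler_pdivrMr //.
    by have := ler_wpM2l (ltW e0) mt; move: u1 v1; clear; lra.
  have s1 := small _ _ _ hn (ltac:(by rewrite /m ge_min lexx) : m <= `|h|) f2 f1.
  have s2 := small _ _ _ hn' (ltac:(by rewrite /m ge_min lexx orbT) : m <= `|h'|) f3 f1.
  have -> : E x h - E x h' = (E x h - derive1 f x) - (E x h' - derive1 f x) by ring.
  by apply: (le_trans (ler_normB _ _)); move: e1 e2 s1 s2; clear; lra.
have dk x : 0 < x -> derivable k x 1.
  move=> x0.
  have x20 : 0 < x / 2 by lra.
  have [M M0 HM] := Ecauchy _ x20.
  apply: cauchy_cvg; apply: cauchy_exP => e e0.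
  pose h0 := Num.min (x / 2) (e / (4 * M)).
  have h00 : 0 < h0 by rewrite lt_min x20 divr_gt0 // mulr_gt0.
  have h0x : h0 <= x / 2 by rewrite ge_min lexx.
  have h0e : h0 * (4 * M) <= e by rewrite -ler_pdivlMr ?mulr_gt0 // ge_min lexx orbT.
  exists (E x h0); apply/nbhs_ballP; exists h0 => //= h.
  rewrite /ball /= sub0r normrN => hh hn0.
  have -> : h^-1 *: (k (h *: 1 + x) - k x) = E x h.
    by rewrite /E /GRing.scale /= mulr1 (addrC h).
  have hx : x / 2 <= x + h by move: hh; rewrite ltr_norml => /andP[]; lra.
  have := HM x h0 h ltac:(lra) ltac:(lra) hx (lt0r_neq0 h00) hn0.
  move=> /le_lt_trans; apply; rewrite (ger0_norm (ltW h00)).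
  have : M * `|h| <= M * h0 by rewrite ler_pM2l // ltW.
  have := mulr_gt0 M0 h00; lra.
have Elim a : 0 < a -> exists2 M, 0 < M & forall x h, a < x -> a <= x + h ->
    h != 0 -> `|E x h - derive1 k x| <= M * `|h|.
  move=> a0; have [M M0 HM] := Ecauchy _ a0; exists M => // x h ax ah h0.
  apply/ler_addgt0Pr => e e0.
  have := dk x (lt_trans a0 ax) => /cvgrPdist_lt.
  have e2 : 0 < e / 2 by lra.
  move=> /(_ _ e2)/nbhs_ballP[d /= d0 Hd].
  pose h' := Num.min (d / 2) (e / 4 / M).
  have h'0 : 0 < h' by rewrite lt_min !divr_gt0.
  have h'd : h' <= d / 2 by rewrite ge_min lexx.
  have h'e : h' * M <= e / 4 by rewrite -ler_pdivlMr // ge_min lexx orbT.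
  have h'n : `|h'| = h' by rewrite ger0_norm // ltW.
  have h'k : `|derive1 k x - E x h'| < e / 2.
    have := Hd h'; rewrite /ball /= sub0r normrN h'n => /(_ ltac:(lra) (lt0r_neq0 h'0)).
    rewrite derive1E /E (addrC x).
    by rewrite (_ : h' *: 1 = h') // /GRing.scale /= mulr1.
  have := HM x h h' (ltW ax) ah (ltac:(lra) : a <= x + h') h0 (lt0r_neq0 h'0).
  have -> : E x h - derive1 k x = (E x h - E x h') - (derive1 k x - E x h') by ring.
  move=> hM; rewrite h'n in hM; apply: (le_trans (ler_normB _ _)).
  lra.
split=> // s e s0 e0.
have [a a0 sa] := seq_lb s0.
have a20 : 0 < a / 2 by lra.
have [M M0 HM] := Elim _ a20; have [M' M'0 HM'] := bnd _ a20.
(* The fixed step: the two second-order errors add up to [e / 4], and precision [e * h / 8] at both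
   ends adds another [e / 4]. *)
pose h := e / (4 * (M + M')).
have MM : 0 < M + M' by lra.
have h0 : 0 < h by rewrite divr_gt0 // mulr_gt0.
have hE : h * (M + M') = e / 4 by rewrite /h; field; rewrite gt_eqF.
have [||f Sf [Hf tay]] := HM' (s ++ [seq x + h | x <- s]) (e * h / 8).
- by move=> x; rewrite mem_cat => /orP[/sa|/mapP[y /sa ya ->]]; move: a0 h0;
  [clear|move: ya; clear]; lra.
- by rewrite divr_gt0 // mulr_gt0.
exists (derive1 f); first by exists f.
move=> x xs; have ax := sa x xs.
have f1 := Hf x; have f2 := Hf (x + h).
rewrite !mem_cat xs in f1; rewrite mem_cat (map_f (fun x => x + h)) // orbT in f2.
have {}f1 := f1 isT; have {}f2 := f2 isT.
have [ax2 axh] : a / 2 < x /\ a / 2 <= x + h by move: a0 ax h0; clear; split; lra.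
have e1 := HM x h ax2 axh (lt0r_neq0 h0).
have e2 := E1 f (a / 2) M' x h tay (lt0r_neq0 h0) (ltW ax2) axh.
rewrite (ger0_norm (ltW h0)) in e1 e2.
have e3 : (`|k (x + h) - f (x + h)| + `|k x - f x|) / h <= e / 4.
  by rewrite ler_pdivrMr //; move: f1 f2; clear; lra.
have -> : derive1 k x - derive1 f x = (E x h - derive1 f x) - (E x h - derive1 k x) by ring.
by apply: (le_lt_trans (ler_normB _ _)); move: e1 e2 e3 hE e0; clear; lra.
Qed.

Lemma approx_CM k : approx CM k -> CM k.
Proof.
move=> Ck n; elim: n k Ck => [|n IH] k Ck.
  by split=> // x x0; apply: (approx_ge0 Ck) => // f cf; exact: cm_upto_ge0 (cf 0%N) x0.
split; first by move=> x x0; apply: (approx_ge0 Ck) => // f cf;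
  exact: cm_upto_ge0 (cf 0%N) x0.
have [|dk ak] := approx_derive _ Ck.
  move=> a a0; exists (a / 4), (8 / a ^+ 2); split; [lra|by rewrite divr_ge0 ?sqr_ge0|].
  by move=> f x y cf ax ay; apply: CM_taylor.
exists (fun x => - derive1 k x).
  by move=> x x0; rewrite opprK derive1E; apply/derivableP/dk.
apply: IH => s e s0 e0; have [_ [f cf <-] Hf] := ak s e s0 e0.
exists (fun x => - derive1 f x); first by have [] := CM_derive cf.
by move=> x /Hf; rewrite -opprD normrN.
Qed.

Lemma approx_bernstein g : approx (@bernstein R) g -> bernstein g.
Proof.
move=> Bg.
have [|dg ag] := approx_derive _ Bg.
  move=> a a0; exists (a / 2), (8 / a ^+ 2); split; [lra|by rewrite divr_ge0 ?sqr_ge0|].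
  by move=> f x y cf ax ay; apply: bernstein_taylor.
apply: CM_bernstein => //.
  move=> x x0; apply: (approx_ge0 Bg) => // f [f0 _ _]; exact: f0.
apply: approx_CM => s e s0 e0; have [_ [f Bf <-] Hf] := ag s e s0 e0.
by exists (derive1 f); first by have [_ _] := bernstein_CM Bf.
Qed.
End BernsteinLimits.

(** * Functions with nonpositive Dini derivative *)

Section Monotone.
Context {R : realType}.
Implicit Types (a b t u h e : R) (d : R -> R) (s : seq (R * R)).

Lemma real_induction (P : R -> Prop) a b : a <= b -> P a ->
  (forall t, a <= t < b -> P t -> exists2 e, 0 < e &
     forall h, 0 < h < e -> t + h <= b -> P (t + h)) ->
  (forall t, a < t <= b -> (forall u, a <= u < t -> P u) -> P t) ->
  P b.
Proof.
move=> ab Pa Pright Psup.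
pose S := [set t | a <= t <= b /\ forall u, a <= u <= t -> P u].
have Sa : S a.
  split; first by rewrite lexx.
  by move=> u; rewrite -eq_le => /eqP <-.
have ubS : ubound S b by move=> t [/andP[]].
have supS : has_sup S by split; [exists a|exists b].
set c := sup S.
have ac : a <= c by apply: ub_le_sup Sa; exists b.
have cb : c <= b by apply: ge_sup => //; exists a.
have below u : a <= u < c -> P u.
  move=> /andP[au uc].
  have e0 : 0 < c - u by rewrite subr_gt0.
  have [t St ut] := sup_adherent e0 supS.
  have [_ +] := St; apply; rewrite au /=.
  by move: ut; rewrite -/c; lra.
have Pc : P c.
  move: ac; rewrite le_eqVlt => /orP[/eqP <- //|ac].
  by apply: Psup => //; rewrite ac.
have Sc : S c.
  split; first by rewrite ac.
  move=> u /andP[au]; rewrite le_eqVlt => /orP[/eqP -> //|uc].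
  by apply: below; rewrite au.
have [<- //|cneb] := eqVneq c b.
have ltcb : c < b by rewrite lt_neqAle cneb.
have [e e0 He] := Pright c ltac:(by rewrite ac) Pc.
pose h := Num.min (e / 2) (b - c).
have h0 : 0 < h by rewrite lt_min subr_gt0 ltcb divr_gt0.
have he : h <= e / 2 by rewrite ge_min lexx.
have hb : h <= b - c by rewrite ge_min lexx orbT.
have : S (c + h).
  split; first by apply/andP; split; lra.
  move=> u /andP[au uch]; have [uc|cu] := leP u c.
    by have [_] := Sc; apply; rewrite au.
  by rewrite -(subrK c u) addrC; apply: He; [apply/andP; split; lra|lra].
move=> Sch; have : c + h <= c by apply: ub_le_sup Sch; exists b.
lra.
Qed.

(** Real induction on [d t <= d a + e * (t - a)]: the Dini condition moves right, and lower
    semicontinuity from the left passes to suprema. Continuity of [d] would be more than the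
    semigroup case readily offers. *)
Lemma dini_nonincr a b d : a <= b ->
  (forall t, a < t <= b -> forall e, 0 < e -> exists2 u, a <= u < t &
     forall v, u <= v < t -> d t <= d v + e) ->
  (forall t, a <= t < b -> forall e, 0 < e -> exists2 k, 0 < k &
     forall h, 0 < h < k -> t + h <= b -> d (t + h) <= d t + e * h) ->
  d b <= d a.
Proof.
move=> ab lsc dini.
have key e : 0 < e -> d b <= d a + e * (b - a).
  move=> e0; apply: (@real_induction (fun t => d t <= d a + e * (t - a)) a b) => //.
  - by rewrite subrr mulr0 addr0.
  - move=> t tab Pt; have [k k0 Hk] := dini t tab e e0; exists k => // h hk thb.
    have := Hk h hk thb; lra.
  - move=> t atb H; apply/ler_addgt0Pr => r r0.
    have [u /andP[au ut] Hu] := lsc t atb r r0.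
    have := H u ltac:(by rewrite au); have := Hu u ltac:(by rewrite lexx).
    have : e * (u - a) <= e * (t - a) by rewrite ler_pM2l //; lra.
    lra.
apply/ler_addgt0Pr => r r0.
have [->|bna] := eqVneq b a; first by rewrite lerDl ltW.
have ba : 0 < b - a by rewrite subr_gt0 lt_neqAle eq_sym bna.
have := key (r / (b - a)) ltac:(by rewrite divr_gt0).
by rewrite divfK ?gt_eqF.
Qed.

(** A null set of the completed measure lies in a Borel null set, and outer regularity applies to
    the latter. *)
Lemma null_open_cover (N : set R) e : 0 < e ->
  (@completed_lebesgue_measure R).-negligible (N : set (lebesgueR R)) ->
  exists U : set R, [/\ open U, N `<=` U & (@lebesgue_measure R U < e%:E)%E].
Proof.
move=> e0 [A [mA A0 NA]].
have : (completed_algebra_gen (@lebesgue_measure R)).-sigma.-measurable (A : set R).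
  by rewrite completed_caratheodory_measurable.
rewrite g_sigma_completed_algebra_genE => -[X mX [N' [B [mB B0 N'B]] XN'A]].
have mD : measurable (X `|` B : set (measurableTypeR R)) by exact: measurableU.
have X0 : (@lebesgue_measure R X = 0)%E.
  apply/eqP; rewrite eq_le measure_ge0 andbT -[leRHS]A0.
  by apply: le_outer_measure; rewrite -XN'A; exact: subsetUl.
have D0 : (@lebesgue_measure R (X `|` B) = 0)%E.
  by rewrite measureU0.
have Dfin : (@lebesgue_measure R (X `|` B) < +oo)%E by rewrite D0.
have [U [oU DU Ue]] := lebesgue_regularity_outer mD Dfin e0.
exists U; split=> //.
  move=> x /NA; rewrite -XN'A => -[Xx|/N'B Bx]; apply: DU; [by left|by right].
have mU : measurable (U : set (measurableTypeR R)) by exact: open_measurable.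
apply: le_lt_trans Ue.
by rewrite -{1}(setDUK DU) setUC measureU0 //; exact: measurableD.
Qed.

(** Nonoverlapping intervals kept as an increasing list, which an interval at the right end
    extends. *)
Definition ordered_in a b s := pairwise (fun p q : R * R => p.2 <= q.1) s /\
  forall p, p \in s -> [/\ a <= p.1, p.1 <= p.2 & p.2 <= b].

Definition seq_ac a b d := forall e, 0 < e -> exists2 k, 0 < k &
  forall s, ordered_in a b s -> \sum_(p <- s) (p.2 - p.1) < k ->
    \sum_(p <- s) `|d p.2 - d p.1| < e.

Lemma seq_ac_le_pair a b d e : 0 < e -> seq_ac a b d -> exists2 k, 0 < k &
  forall u v, a <= u -> u <= v -> v <= b -> v - u < k -> `|d v - d u| < e.
Proof.
move=> e0 /(_ e e0)[k k0 Hk]; exists k => // u v au uv vb vuk.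
have := Hk [:: (u, v)]; rewrite !big_seq1 /=; apply=> //.
by split=> // p; rewrite inE => /eqP ->.
Qed.

(** Cover [N] by an open [U] shorter than the [k] of absolute continuity for [e]. Moving right from
    [a], the increase of [d] is controlled by the Dini condition off [N], and near [N] by its
    variation over intervals in [U], whose sum stays below [e]. *)
Lemma ac_nonincr a b d (N : set R) : a <= b -> seq_ac a b d ->
  (@completed_lebesgue_measure R).-negligible (N : set (lebesgueR R)) ->
  (forall t, a <= t < b -> ~ N t -> forall e, 0 < e -> exists2 k, 0 < k &
     forall h, 0 < h < k -> t + h <= b -> d (t + h) <= d t + e * h) ->
  d b <= d a.
Proof.
move=> ab dac N0 dini.
suff key e : 0 < e -> d b - d a <= e * (b - a) + e.
  apply/ler_addgt0Pr => r r0.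
  have ba1 : 0 < b - a + 1 by lra.
  have := key (r / (b - a + 1)) ltac:(by rewrite divr_gt0).
  have -> : r / (b - a + 1) * (b - a) + r / (b - a + 1) = r by field; rewrite gt_eqF.
  lra.
move=> e0.
have [k k0 Hk] := dac e e0.
have [U [oU NU Uk]] := null_open_cover k0 N0.
pose mu := @lebesgue_measure R.
have mU : measurable (U : set (measurableTypeR R)) by exact: open_measurable.
pose m t := mu (U `&` `[a, t]%classic).
have mI t : measurable (U `&` `[a, t]%classic : set (measurableTypeR R)).
  by apply: measurableI.
(* The error [r] is quantified inside [P]: at a supremum the list is inherited from a slightly
   earlier time with error [r / 2], and continuity uses the other half. *)
pose P t := forall r, 0 < r -> exists s, [/\ ordered_in a t s,
  ((\sum_(p <- s) (p.2 - p.1))%:E <= m t)%E &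
  d t - d a <= e * (t - a) + r + \sum_(p <- s) `|d p.2 - d p.1|].
have wid t t' s : t <= t' -> ordered_in a t s -> ordered_in a t' s.
  move=> tt' [ps hs]; split=> // p /hs[h1 h2 h3]; split=> //; exact: le_trans tt'.
have mono t t' : t <= t' -> (m t <= m t')%E.
  move=> tt'; apply: le_outer_measure; apply: setIS => x /=.
  by rewrite !in_itv /= => /andP[-> /le_trans]; apply.
have Pb : P b.
  apply: (@real_induction P a b) => //.
  - move=> r r0; exists [::]; split.
    + by split.
    + by rewrite big_nil; exact: measure_ge0.
    + by rewrite big_nil !subrr mulr0; lra.
  (* At [t] in [N] nothing is known about [d]; the interval from [t] to [t + h] joins the list, and
     its length is charged to the measure of [U]. *)
  - move=> t tab Pt; have [Nt|nNt] := pselect (N t).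
      have /nbhs_ballP[/= q q0 Hq] : nbhs t U by apply: open_nbhs_nbhs; split=> //;
        exact: NU.
      exists q => // h /andP[h0 hq] thb r r0; have [s [os ms ds]] := Pt r r0.
      exists (rcons s (t, t + h)); split.
      + split.
          rewrite pairwise_rcons; have [-> hs] := os; rewrite andbT.
          by apply/allP => p /hs[].
        move=> p; rewrite mem_rcons inE => /orP[/eqP -> /=|ps].
          by move: tab h0; clear => /andP[? ?] ?; split; lra.
        have [p1 p2 p3] := os.2 p ps; split=> //; move: p3 h0; clear; lra.
      + rewrite -cats1 big_cat big_seq1 /= EFinD.
        pose J : set R := `]t, t + h]%classic.
        apply: (@le_trans _ _ (m t + mu J)%E).
          apply: leeD => //.
          by rewrite /mu /J lebesgue_measure_itv /= lte_fin ltrDl h0 -EFinB addrC addKr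
            lee_fin; lra.
        rewrite /m /J -measureU //; last first.
        * apply/seteqP; split=> // x [[_ /=]];
          rewrite !in_itv /= => /andP[_ xt] /andP[tx _].
          by move: tx; rewrite ltNge xt.
        * apply: le_outer_measure => x [[Ux]|]; rewrite /= in_itv /= => /andP[x1 x2];
          (split=> /=; last by
              rewrite in_itv /=; move: tab x1 x2 h0; clear => /andP[? ?] ? ? ?;
                apply/andP; split; lra) => //.
          by apply: Hq; rewrite /ball /= ltr0_norm; move: hq x1 x2; clear; lra.
      + rewrite -cats1 big_cat big_seq1 /=.
        have := ler_norm (d (t + h) - d t).
        have : 0 <= e * h by rewrite mulr_ge0 ?ltW.
        lra.
    have [q q0 Hq] := dini t tab nNt e e0; exists q => // h hq thb r r0.
    have [s [os ms ds]] := Pt r r0; exists s; split.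
    + by apply: wid os; lra.
    + by apply: (le_trans ms); apply: mono; lra.
    + have := Hq h hq thb; lra.
  - move=> t /andP[at_ tb] H r r0.
    have r20 : 0 < r / 2 by lra.
    have [q q0 Hq] := seq_ac_le_pair r20 dac.
    pose u := Num.max a (t - q / 2).
    have au : a <= u by rewrite le_max lexx.
    have uq : t - q / 2 <= u by rewrite le_max lexx orbT.
    have ut : u < t by rewrite gt_max at_; lra.
    have [s [os ms ds]] := H u ltac:(by rewrite au) (r / 2) r20.
    exists s; split.
    + by apply: wid os; lra.
    + by apply: (le_trans ms); apply: mono; lra.
    + have := Hq u t au (ltW ut) tb ltac:(lra) => /(le_lt_trans (ler_norm _)).
      have : e * (u - a) <= e * (t - a) by rewrite ler_pM2l //; lra.
      lra.
apply/ler_addgt0Pr => r r0.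
have [s [os ms ds]] := Pb r r0.
have sk : \sum_(p <- s) (p.2 - p.1) < k.
  rewrite -lte_fin; apply: (le_lt_trans ms); apply: le_lt_trans Uk.
  by apply: le_outer_measure; exact: subIsetl.
have := Hk s os sk; lra.
Qed.
End Monotone.

(** * The distance to the Bernstein functions *)

Section Distance.
Local Open Scope complex_scope.
Context {R : realType}.
Local Notation Re := complex.Re.
Local Notation Im := complex.Im.
Implicit Types (a b z p q : R[i]) (x y e h : R) (xs : seq R) (g : R -> R).

Lemma pdist_ge0 a b : 0 <= pdist a b.
Proof. by rewrite divr_ge0 ?cabs_ge0. Qed.

Lemma pdist_lip a a' b : 0 < Re a -> 0 < Re a' -> 0 < Re b ->
  pdist a' b <= pdist a b + 2 * cabs (a' - a) / Re a'.
Proof.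
move=> a0 a'0 b0.
have D0 := pdist_den_gt0 a0 b0; have D'0 := pdist_den_gt0 a'0 b0.
have D : 0 < cabs (a + b^*) by apply: lt_le_trans D0; rewrite addr_gt0.
have D' : 0 < cabs (a' + b^*) by apply: lt_le_trans D'0; rewrite addr_gt0.
have nD : a + b^* != 0 by rewrite -cabs_gt0.
have nD' : a' + b^* != 0 by rewrite -cabs_gt0.
have pE c : pdist c b = cabs ((c - b) / (c + b^*)) by rewrite cabsM cabsV.
have -> : pdist a' b = cabs ((a - b) / (a + b^*) + (a' - a) * (b + b^*) / ((a
  + b^*) * (a' + b^*))).
  by rewrite pE; congr cabs; field; rewrite ?nD ?nD'.
apply: (le_trans (cabsD _ _)); rewrite -pE lerD2l.
rewrite !cabsM cabsV cabsM addcJ cabsM !cabs_real (ger0_norm (ltW b0)).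
have -> : cabs (2 : R[i]) = 2.
  by rewrite (_ : 2 = (2 : R)%:C) ?cabs_real ?ger0_norm // rmorph_nat.
rewrite ler_pdivrMr ?mulr_gt0 //.
have c0 := cabs_ge0 (a' - a).
have h1 : Re b * Re a' <= cabs (a + b^*) * cabs (a' + b^*).
  by apply: ler_pM; rewrite ?ltW //; lra.
have -> : 2 * cabs (a' - a) / Re a' * (cabs (a + b^*) * cabs (a' + b^*)) =
   2 * cabs (a' - a) * ((cabs (a + b^*) * cabs (a' + b^*)) / Re a') by ring.
have h2 : Re b <= cabs (a + b^*) * cabs (a' + b^*) / Re a' by rewrite ler_pdivlMr.
have := ler_wpM2l (ltac:(lra) : 0 <= 2 * cabs (a' - a)) h2; lra.
Qed.

Lemma cabs_le_pdist a b : 0 < Re a -> 0 < Re b -> pdist a b <= 1 / 2 ->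
  cabs (a - b) <= 4 * Re a * pdist a b.
Proof.
move=> a0 b0 d2.
have D : 0 < cabs (a + b^*) by apply: lt_le_trans (pdist_den_gt0 a0 b0); rewrite addr_gt0.
have E : cabs (a - b) = pdist a b * cabs (a + b^*) by rewrite /pdist divfK ?gt_eqF.
have h : cabs (a + b^*) <= cabs (a - b) + 2 * Re a.
  have -> : a + b^* = (b - a)^* + (2 * Re a)%:C.
    by case: (a) => ? ?; case: (b) => ? ?; apply/eqP; rewrite eq_complex /=; apply/andP;
      split; apply/eqP; ring.
  apply: (le_trans (cabsD _ _)); rewrite cabsJ cabsB cabs_real ger0_norm //.
  by rewrite mulr_ge0 // ltW.
have := pdist_ge0 a b => d0.
have := ler_wpM2l d0 h; rewrite -E.
have : pdist a b * cabs (a - b) <= 1 / 2 * cabs (a - b) by rewrite ler_wpM2r ?cabs_ge0.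
lra.
Qed.

Lemma pdist_le_cabs a b : 0 < Re a -> 0 < Re b -> pdist a b <= cabs (a - b) / Re b.
Proof.
move=> a0 b0; have D := pdist_den_gt0 a0 b0.
have D0 : 0 < cabs (a + b^*) by apply: lt_le_trans D; rewrite addr_gt0.
by rewrite /pdist ler_wpM2l ?cabs_ge0 // lef_pV2 ?posrE //; lra.
Qed.

(** Positivity puts the values in the half-plane, where [pdist] is controlled, and allows
    composition. *)
Definition pos_bernstein : set (R -> R) :=
  [set g | bernstein g /\ forall x, 0 < x -> 0 < g x].

Definition bernstein_dist xs (X : R -> R[i]) : R :=
  inf [set \sum_(x <- xs) pdist (X x) (g x)%:C | g in pos_bernstein].

Lemma pos_bernstein_id : pos_bernstein (fun x => x).
Proof. by split=> //; exact: bernstein_id. Qed.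

Lemma bernstein_dist_le xs X g : pos_bernstein g ->
  bernstein_dist xs X <= \sum_(x <- xs) pdist (X x) (g x)%:C.
Proof.
move=> Bg; apply: ge_inf; last by exists g.
by exists 0 => _ [f _ <-]; apply: sumr_ge0 => i _; exact: pdist_ge0.
Qed.

Lemma bernstein_dist_lt xs X e : 0 < e -> exists2 g, pos_bernstein g &
  \sum_(x <- xs) pdist (X x) (g x)%:C < bernstein_dist xs X + e.
Proof.
move=> e0; have [|_ [g Bg <-] lt] := @inf_adherent _
  [set \sum_(x <- xs) pdist (X x) (g x)%:C | g in pos_bernstein] _ e0.
  split; first by exists (\sum_(x <- xs) pdist (X x) x%:C), (fun x => x) => //;
    exact: pos_bernstein_id.
  by exists 0 => _ [f _ <-]; apply: sumr_ge0 => i _; exact: pdist_ge0.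
by exists g.
Qed.

Lemma bernstein_dist_id xs : (forall x, x \in xs -> 0 < x) ->
  bernstein_dist xs (fun x => x%:C) <= 0.
Proof.
move=> xs0; apply: (le_trans (bernstein_dist_le _ _ pos_bernstein_id)).
by rewrite big1 // => x _; rewrite /pdist subrr cabs0 mul0r.
Qed.

(** If [g] nearly minimizes for [X], then [k] after [g] is a competitor for [X']. Schwarz-Pick keeps
    the first term with factor 1, and by [pdist_lip] the error is independent of [g]. *)
Lemma bernstein_dist_step xs (X X' : R -> R[i]) (k : cplx R -> cplx R) :
  (forall x, x \in xs -> [/\ 0 < x, 0 < Re (X x) & 0 < Re (X' x)]) ->
  Hol (halfplane R) (halfplane R) k -> BF R k ->
  bernstein_dist xs X' <= bernstein_dist xs X
    + \sum_(x <- xs) 2 * cabs (X' x - k (X x)) / Re (X' x).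
Proof.
move=> xsP Hk [_ [ka [kE Bk _]]].
have ka0 x : 0 < x -> 0 < ka x.
  by move=> x0; have := Hk.2 x%:C x0; rewrite /halfplane /= kE.
apply/ler_addgt0Pr => e e0.
have [g [Bg g0] Hg] := bernstein_dist_lt xs X e0.
have Bkg : pos_bernstein (fun x => ka (g x)).
  by split; [exact: bernstein_comp|move=> x x0; apply/ka0/g0].
apply: (le_trans (bernstein_dist_le _ _ Bkg)).
apply: (@le_trans _ _ (\sum_(x <- xs) pdist (X x) (g x)%:C
  + \sum_(x <- xs) 2 * cabs (X' x - k (X x)) / Re (X' x))); last by lra.
rewrite -big_split /= big_seq [leRHS]big_seq; apply: ler_sum => x /xsP[x0 X0 X'0].
have gx := g0 x x0; have kgx := ka0 _ gx.
apply: (le_trans (@pdist_lip (k (X x)) (X' x) _ _ _ _)) => //; first exact: Hk.2.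
by rewrite lerD2r -kE //; apply: schwarz_pick.
Qed.

(** Distance 0 at every finite list puts [v] on (0, +oo) in the pointwise closure of the Bernstein
    functions; as these are real, so is [v] there. *)
Lemma bernstein_dist_le0_BF (v : cplx R -> cplx R) : Hol (halfplane R) (halfplane R) v ->
  (forall xs, (forall x, x \in xs -> 0 < x) -> bernstein_dist xs (fun x => v x%:C) <= 0) ->
  BF R v.
Proof.
move=> [dv vH] dv0.
have v0 x : 0 < x -> 0 < Re (v x%:C) by move=> x0; exact: vH.
have app xs e : (forall x, x \in xs -> 0 < x) -> 0 < e ->
    exists2 g, pos_bernstein g & forall x, x \in xs -> cabs (v x%:C - (g x)%:C) < e.
  move=> xs0 e0.
  (* [M] bounds [Re (v x)] over the list; by [cabs_le_pdist] a pseudo-hyperbolic error below [r] is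
     then an error of at most [4 * M * r <= e / 2]. *)
  pose M := 1 + \sum_(x <- xs) Re (v x%:C).
  have M1 : 1 <= M by rewrite lerDl big_seq sumr_ge0 // => x /xs0/v0/ltW.
  pose r := Num.min (1 / 2) (e / (8 * M)).
  have r0 : 0 < r by rewrite lt_min !divr_gt0 // mulr_gt0 //; lra.
  have r2 : r <= 1 / 2 by rewrite ge_min lexx.
  have rM : r * (8 * M) <= e by rewrite -ler_pdivlMr ?mulr_gt0 ?ge_min ?lexx ?orbT //; lra.
  have [g Bg Hg] := bernstein_dist_lt xs (fun x => v x%:C) r0.
  exists g => // x xxs.
  have gx : 0 < g x by apply: Bg.2; exact: xs0.
  have px : pdist (v x%:C) (g x)%:C < r.
    have : bernstein_dist xs (fun x => v x%:C) + r <= r by rewrite gerDr dv0.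
    move=> /(lt_le_trans Hg); apply: le_lt_trans.
    rewrite (big_rem x) //= lerDl; apply: sumr_ge0 => i _; exact: pdist_ge0.
  have vx := v0 _ (xs0 _ xxs).
  have := @cabs_le_pdist (v x%:C) (g x)%:C vx gx ltac:(lra).
  have vM : Re (v x%:C) <= M.
    rewrite /M (big_rem x) //= addrCA lerDl addr_ge0 // big_seq sumr_ge0 // =>
      y /mem_rem /xs0/v0/ltW//.
  have p0 := pdist_ge0 (v x%:C) (g x)%:C.
  have : 4 * Re (v x%:C) * pdist (v x%:C) (g x)%:C <= 4 * M * r.
    by apply: ler_pM => //; [rewrite mulr_ge0 ?ltW|rewrite ler_pM2l|exact: ltW].
  have : 0 < M * r by rewrite mulr_gt0 //; lra.
  lra.
split; first by split=> // z z0; exact: dv.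
exists (fun x => Re (v x%:C)); split.
- move=> x x0; apply/eqP; rewrite eq_complex /= eqxx /=; apply/eqP.
  apply/eqP; rewrite -normr_le0; apply/ler_addgt0Pr => e e0; rewrite add0r.
  have [|g _ Hg] := app [:: x] e _ e0; first by move=> y; rewrite inE => /eqP ->.
  have := Hg x (mem_head _ _) => /ltW; apply: le_trans.
  by apply: le_trans (Im_le_cabs _); rewrite ImB /= subr0.
- apply: approx_bernstein => xs e xs0 e0; have [g [Bg _] Hg] := app xs e xs0 e0.
  exists g => // x /Hg; apply: le_lt_trans.
  by apply: le_trans (Re_le_cabs _); rewrite ReB.
- by exists 1 => //; rewrite gt_eqF // v0.
Qed.
End Distance.

(** * Minty's argument *)

Section Minty.
Local Open Scope complex_scope.
Context {R : realType}.
Local Notation Re := complex.Re.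
Local Notation Im := complex.Im.
Implicit Types (a b z p q u w c : R[i]) (x y e h : R).

(** With [cabs_addJ_sqr] both squared distances have the form [A / (A + 4 * P)], and comparing them
    is comparing [A / P]. *)
Lemma schwarz_pick_sqr (F : cplx R -> cplx R) p q :
  Hol (halfplane R) (halfplane R) F -> 0 < Re p -> 0 < Re q ->
  cabs (F p - F q) ^+ 2 * (Re p * Re q) <= cabs (p - q) ^+ 2 * (Re (F p) * Re (F q)).
Proof.
move=> HF p0 q0.
have Fp0 : 0 < Re (F p) by exact: HF.2.
have Fq0 : 0 < Re (F q) by exact: HF.2.
have := schwarz_pick HF p0 q0.
rewrite -(@ler_pXn2r _ 2) ?nnegrE ?pdist_ge0 // /pdist !exprMn !exprVn !cabs_addJ_sqr.
have PQ : 0 < Re p * Re q by rewrite mulr_gt0.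
have FPQ : 0 < Re (F p) * Re (F q) by rewrite mulr_gt0.
have A := sqr_ge0 (cabs (p - q)); have B := sqr_ge0 (cabs (F p - F q)).
rewrite ler_pdivrMr; last by lra.
rewrite mulrAC ler_pdivlMr; last by lra.
lra.
Qed.

Lemma Re_conjM u z : Re (u^* * z) = Re u * Re z + Im u * Im z.
Proof. by case: u => ? ?; case: z => ? ? /=; ring. Qed.

Lemma Re_conjM_le u z : Re (u^* * z) <= cabs u * cabs z.
Proof.
by apply: le_trans (ler_norm _) _; apply: le_trans (Re_le_cabs _) _; rewrite cabsM cabsJ.
Qed.

Lemma cabs_sqrB_ge u w h :
  cabs u ^+ 2 - 2 * h * Re (u^* * w) <= cabs (u - h%:C * w) ^+ 2.
Proof.
rewrite Re_conjM !cabs_sqr; case: u => u1 u2; case: w => w1 w2 /=.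
have := sqr_ge0 (h * w1); have := sqr_ge0 (h * w2); lra.
Qed.

(* Schwarz-Pick makes [(id - F) / h] monotone, up to terms of order [|u|^2]. *)
Lemma pick_monotone (F : cplx R -> cplx R) p q c (D : R[i]) h (sigma : R) :
  D = (q - F q) / h%:C - c ->
  Hol (halfplane R) (halfplane R) F -> 0 < Re p -> 0 < Re q -> 0 < h <= 1 ->
  cabs (p - q) <= Re q / 2 ->
  cabs ((p - F p) / h%:C - c) <= sigma -> sigma <= 1 ->
  Re ((p - q)^* * D) <= cabs (p - q) * sigma +
    cabs (p - q) ^+ 2 * ((cabs c + 1) * (3 * Re q + cabs c + 1) / Re q ^+ 2) * (1 + cabs D).
Proof.
move=> D_def HF p0 q0 /andP[h0 h1] upq Gps sigma1.
have hC : h%:C != 0 :> R[i] by rewrite (inj_eq (@complexI R)) gt_eqF.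
set u := p - q.
pose Gp := (p - F p) / h%:C; pose Gq := (q - F q) / h%:C.
have FpE : F p = p - h%:C * Gp by rewrite /Gp mulrC divfK // subKr.
have FqE : F q = q - h%:C * Gq by rewrite /Gq mulrC divfK // subKr.
have reh z : Re (h%:C * z) = h * Re z by case: z => ? ? /=; ring.
have imh z : Im (h%:C * z) = h * Im z by case: z => ? ? /=; ring.
have sp := schwarz_pick_sqr HF p0 q0.
pose w := Gp - Gq.
have wE : F p - F q = u - h%:C * w by rewrite FpE FqE /w /u; ring.
have low : cabs u ^+ 2 - 2 * h * Re (u^* * w) <= cabs (F p - F q) ^+ 2.
  by rewrite wE; exact: cabs_sqrB_ge.
rewrite -/u in sp.
have PQ : 0 < Re p * Re q by rewrite mulr_gt0.
have RFp : Re (F p) = Re p - h * Re Gp by rewrite FpE ReB reh.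
have RFq : Re (F q) = Re q - h * Re Gq by rewrite FqE ReB reh.
(* Writing [F] as the identity minus [h] times the quotient, the terms of order 0 in [h] cancel and
   one factor [h] divides out. *)
have key : - 2 * Re (u^* * w) * (Re p * Re q) <=
    cabs u ^+ 2 * (- (Re p * Re Gq) - Re q * Re Gp + h * (Re Gp * Re Gq)).
  have s1 := le_trans (ler_wpM2r (ltW PQ) low) sp.
  rewrite RFp RFq in s1.
  rewrite -(ler_pM2l h0); lra.
have DE : Re (u^* * w) = Re (u^* * (Gp - c)) - Re (u^* * D).
  by rewrite !Re_conjM /w D_def !ReB !ImB -/Gq; ring.
have r1 : Re (u^* * (Gp - c)) <= cabs u * sigma.
  by apply: (le_trans (Re_conjM_le _ _)); rewrite ler_wpM2l ?cabs_ge0.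
set Phi := cabs c; set d := cabs D.
have Phi0 : 0 <= Phi by exact: cabs_ge0.
have d0 : 0 <= d by exact: cabs_ge0.
have aP : `|Re Gp| <= Phi + 1.
  apply: (le_trans (Re_le_cabs _)); rewrite -(subrK c Gp) addrC.
  by apply: (le_trans (cabsD _ _)); rewrite lerD2l (le_trans Gps).
have bP : `|Re Gq| <= Phi + d.
  apply: (le_trans (Re_le_cabs _)); rewrite -(subrK c Gq) addrC.
  by apply: (le_trans (cabsD _ _)); rewrite /d D_def.
have Pq : `|Re p - Re q| <= Re q / 2 by rewrite -ReB; apply: le_trans upq;
  exact: Re_le_cabs.
have [P1 P2] : Re q / 2 <= Re p /\ Re p <= 2 * Re q.
  by move: Pq; rewrite ler_norml; clear => /andP[? ?]; split; lra.
set K := (Phi + 1) * (3 * Re q + Phi + 1) * (1 + d).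
have bd : - (Re p * Re Gq) - Re q * Re Gp + h * (Re Gp * Re Gq) <= K.
  have t1 : - (Re p * Re Gq) <= 2 * Re q * (Phi + d).
    apply: (le_trans (ler_norm _)); rewrite normrN normrM (ger0_norm (ltW p0)).
    by apply: ler_pM => //; exact: ltW.
  have t2 : - (Re q * Re Gp) <= Re q * (Phi + 1).
    apply: (le_trans (ler_norm _)); rewrite normrN normrM (ger0_norm (ltW q0)).
    by rewrite ler_wpM2l // ltW.
  have t3 : h * (Re Gp * Re Gq) <= (Phi + 1) * (Phi + d).
    apply: (le_trans (ler_norm _)); rewrite !normrM (ger0_norm (ltW h0)).
    apply: (@le_trans _ _ (`|Re Gp| * `|Re Gq|)); first by rewrite ler_piMl // mulr_ge0.
    by apply: ler_pM.
  have t4 : 0 <= Phi * d by rewrite mulr_ge0.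
  have t5 : 0 <= Re q * (Phi * d) by rewrite mulr_ge0 // ltW.
  have t6 : 0 <= Re q * Phi by rewrite mulr_ge0 // ltW.
  have t7 : 0 <= Re q * d by rewrite mulr_ge0 // ltW.
  have t8 : 0 <= Phi * (Phi * d) by rewrite mulr_ge0.
  rewrite /K; move: t1 t2 t3 t4 t5 t6 t7 t8 Phi0 d0 q0; clear; lra.
have K0 : 0 <= K.
  by rewrite !mulr_ge0 ?addr_ge0 ?mulr_ge0 // ltW.
have U0 := sqr_ge0 (cabs u).
have f1 : 2 * (Re p * Re q) * Re (u^* * D) <=
    2 * (Re p * Re q) * (cabs u * sigma) + cabs u ^+ 2 * K.
  have := ler_wpM2l U0 bd; have := ler_wpM2l (ltW PQ) r1.
  by move: key; rewrite DE; clear; lra.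
have PQ2 : Re q ^+ 2 <= 2 * (Re p * Re q).
  by rewrite expr2 mulrA ler_pM2r //; move: P1; clear; lra.
have q2 : 0 < Re q ^+ 2 by rewrite exprn_gt0.
have f2 : cabs u ^+ 2 * K <= 2 * (Re p * Re q) * (cabs u ^+ 2 * K / Re q ^+ 2).
  rewrite mulrA ler_pdivlMr // mulrC ler_wpM2r // mulr_ge0 //.
have := le_trans f1 (lerD (lexx _) f2).
rewrite -mulrDr ler_pM2l ?mulr_gt0 //.
move/le_trans; apply; rewrite lerD2l le_eqVlt; apply/orP; left; apply/eqP.
by rewrite /K -/Phi -/d; ring.
Qed.

(** First-order contact [F h q = q - h * phi q + o(h)]; the sign is that of the generator, the limit
    of [(id - v_t) / t]. *)
Definition tangent (F : R -> cplx R -> cplx R) (phi : cplx R -> cplx R) q :=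
  forall e, 0 < e -> exists2 k, 0 < k & forall h, 0 < h < k ->
    cabs (F h q - q + h%:C * phi q) <= e * h.

Lemma tangentE (F : cplx R) q c h : 0 < h ->
  cabs (F - q + h%:C * c) = cabs ((q - F) / h%:C - c) * h.
Proof.
move=> h0; have hC : h%:C != 0 :> R[i] by rewrite (inj_eq (@complexI R)) gt_eqF.
rewrite -[X in _ = _ * X](ger0_norm (ltW h0)) -cabs_real -cabsM -cabsN.
by congr cabs; field.
Qed.

(** Minty's trick: test [pick_monotone] at points of [E] near [q + eta * ej] for the four directions
    [ej], and divide by [eta]. Each component of the defect [D] at [q] is then bounded by small
    terms plus a small multiple of [cabs D]. *)
Lemma tangent_dense (F : R -> cplx R -> cplx R) (phi : cplx R -> cplx R)
    (E : set R[i]) (h0 : R) q :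
  0 < h0 -> (forall h, 0 < h < h0 -> Hol (halfplane R) (halfplane R) (F h)) ->
  (forall p, E p -> 0 < Re p) ->
  (forall p e, 0 < Re p -> 0 < e -> exists2 p', E p' & cabs (p' - p) < e) ->
  (forall p, E p -> tangent F phi p) ->
  0 < Re q -> derivable phi q 1 -> tangent F phi q.
Proof.
move=> h00 HF EH dense Etan q0 dphi e e0.
have [l Hl] := cdiffP dphi.
have [dl dl0 Hdl] := cdiff_bounded_quotient Hl.
pose c := phi q.
pose C0 := (cabs c + 1) * (3 * Re q + cabs c + 1) / Re q ^+ 2.
have C00 : 0 <= C0.
  by rewrite divr_ge0 ?sqr_ge0 // !mulr_ge0 ?addr_ge0 ?mulr_ge0 ?cabs_ge0 // ltW.
pose sigma := Num.min 1 (e / 16).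
have s0 : 0 < sigma by rewrite lt_min ltr01 divr_gt0.
have s1 : sigma <= 1 by rewrite ge_min lexx.
have se : sigma <= e / 16 by rewrite ge_min lexx orbT.
pose kap := Num.min (1 / 4) (e / 8).
have k0 : 0 < kap by rewrite lt_min !divr_gt0.
have k1 : kap <= 1 / 4 by rewrite ge_min lexx.
have ke : kap <= e / 8 by rewrite ge_min lexx orbT.
pose L := cabs l + 1.
have L0 : 0 < L by rewrite ltr_wpDl ?cabs_ge0.
(* In order: [p] stays where the difference quotient of [phi] at [q] is bounded; it stays in the
   half-plane and within [Re q / 2] of [q]; the quadratic term is at most [kap / 2] after division
   by [eta]; [phi p - phi q] is at most [sigma / 2]. *)
pose eta := Num.min (Num.min (dl / 4) (Re q / 4)) (Num.min (kap / (8 * (C0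
  + 1))) (sigma / (4 * L))).
have eta0 : 0 < eta.
  rewrite !lt_min !divr_gt0 ?mulr_gt0 //; lra.
have [et1 et2 et3 et4] : [/\ eta <= dl / 4, eta <= Re q / 4,
  eta <= kap / (8 * (C0 + 1)) & eta <= sigma / (4 * L)].
  by split; rewrite /eta !ge_min lexx ?orbT.
have {}et3 : eta * (8 * C0) <= kap.
  have h8 : 0 < 8 * (C0 + 1) by lra.
  rewrite ler_pdivlMr // in et3.
  have : eta * (8 * C0) <= eta * (8 * (C0 + 1)) by rewrite ler_pM2l //; lra.
  lra.
have {}et4 : 4 * (eta * L) <= sigma.
  by rewrite ler_pdivlMr ?mulr_gt0 // in et4; lra.
have dir (ej : R[i]) : cabs ej = 1 -> exists2 k, 0 < k & forall h, 0 < h < k -> 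
    forall D, D = (q - F h q) / h%:C - c ->
    Re (ej^* * D) <= 1 / 8 * cabs D + 2 * sigma + kap / 2 * (1 + cabs D).
  move=> ej1.
  have Rej : `|Re ej| <= 1 by rewrite -ej1 Re_le_cabs.
  have re_eta : Re (eta%:C * ej) = eta * Re ej by case: (ej) => ? ? /=; ring.
  have q'0 : 0 < Re (q + eta%:C * ej).
    rewrite raddfD /= re_eta; have : `|eta * Re ej| <= eta.
      by rewrite normrM (ger0_norm (ltW eta0)) ler_piMr // ltW.
    rewrite ler_norml => /andP[]; lra.
  (* The point of [E] only approximates [q + eta * ej]; this deviation costs [eta / 8 * cabs D]. *)
  have e8 : 0 < eta / 8 by lra.
  have [p Ep Hp] := dense _ _ q'0 e8.
  have p0 := EH p Ep.
  pose r := p - (q + eta%:C * ej).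
  have uE : p - q = eta%:C * ej + r by rewrite /r; ring.
  have nu : cabs (p - q) <= 2 * eta.
    rewrite uE; apply: (le_trans (cabsD _ _)).
    rewrite cabsM cabs_real ej1 mulr1 ger0_norm ?(ltW eta0) //.
    have : cabs r < eta / 8 by []. 
    lra.
  have s2 : 0 < sigma / 2 by lra.
  have [k kpos Hk] := Etan p Ep (sigma / 2) s2.
  exists (Num.min (Num.min k h0) 1); first by rewrite !lt_min kpos h00 ltr01.
  move=> h; rewrite !lt_min => /andP[hpos /andP[/andP[hk hh0] h1]] D D_def.
  have HFh : Hol (halfplane R) (halfplane R) (F h) by apply: HF; rewrite hpos.
  have Gp : cabs ((p - F h p) / h%:C - phi p) <= sigma / 2.
    by have := Hk h; rewrite hpos hk tangentE // ler_pM2r //; apply.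
  have Gpc : cabs ((p - F h p) / h%:C - c) <= sigma.
    have -> : (p - F h p) / h%:C - c = ((p - F h p) / h%:C - phi p) + (phi p - c) by ring.
    apply: (le_trans (cabsD _ _)).
    have := Hdl p ltac:(by move: nu et1 dl0; clear; lra); rewrite -/L.
    have : L * cabs (p - q) <= L * (2 * eta) by rewrite ler_pM2l.
    by move: nu et4 Gp; rewrite /c; clear; lra.
  have := @pick_monotone (F h) p q c D h sigma D_def HFh p0 q0
    ltac:(by rewrite hpos ltW) ltac:(by move: nu et2; clear; lra) Gpc s1.
  rewrite -/C0 => main.
  have ED : Re ((p - q)^* * D) = eta * Re (ej^* * D) + Re (r^* * D).
    rewrite uE !Re_conjM; case: (ej) => ? ?; case: (r) => ? ? /=; ring.
  have rD : - Re (r^* * D) <= eta / 8 * cabs D.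
    apply: (le_trans (ler_norm _)); rewrite normrN; apply: (le_trans (Re_le_cabs _)).
    by rewrite cabsM cabsJ ler_wpM2r ?cabs_ge0 // ltW.
  have D0 := cabs_ge0 D; have u0 := cabs_ge0 (p - q).
  rewrite -(ler_pM2l eta0).
  have m1 : cabs (p - q) * sigma <= 2 * eta * sigma by rewrite ler_pM2r.
  have m2 : cabs (p - q) ^+ 2 * C0 * (1 + cabs D) <= eta * (kap / 2 * (1 + cabs D)).
    rewrite mulrA ler_wpM2r ?addr_ge0 //.
    have : cabs (p - q) ^+ 2 <= 4 * eta ^+ 2.
      have -> : 4 * eta ^+ 2 = (2 * eta) ^+ 2 by ring.
      by rewrite lerXn2r ?nnegrE // mulr_ge0 // ltW.
    move=> /(ler_wpM2r C00) h4; apply: (le_trans h4).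
    by have := ler_wpM2l (ltW eta0) et3; clear; lra.
  by move: main m1 m2 rD; rewrite ED; clear; lra.
have c1 : cabs (1 : R[i]) = 1 by exact: cabs1.
have ci : cabs (0 +i* 1 : R[i]) = 1.
  by rewrite /cabs normc_def /= expr0n expr1n add0r sqrtr1.
have [k1' k10 H1] := dir 1 c1.
have [k2' k20 H2] := dir (-1) (etrans (cabsN _) c1).
have [k3' k30 H3] := dir (0 +i* 1) ci.
have [k4' k40 H4] := dir (- (0 +i* 1)) (etrans (cabsN _) ci).
exists (Num.min (Num.min k1' k2') (Num.min k3' k4'));
  first by rewrite !lt_min k10 k20 k30 k40.
move=> h; rewrite !lt_min => /andP[hpos /andP[/andP[hk1 hk2] /andP[hk3 hk4]]].
rewrite tangentE // ler_pM2r // -/c.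
have := H1 h; rewrite hpos hk1 => /(_ isT _ erefl); have := H2 h;
  rewrite hpos hk2 => /(_ isT _ erefl).
have := H3 h; rewrite hpos hk3 => /(_ isT _ erefl); have := H4 h;
  rewrite hpos hk4 => /(_ isT _ erefl).
set D := (q - F h q) / h%:C - c.
rewrite !Re_conjM /= oppr0 !mul0r !mul1r !mulN1r !addr0 !add0r => i4 i3 i2 i1.
have := cabs_le_ReIm D; have D0 := cabs_ge0 D.
(* Each component of [D] is thus bounded with coefficient at most 1/4 of [cabs D], their sum with
   1/2, and [cabs D] is absorbed. *)
have hk : kap / 2 * cabs D <= 1 / 8 * cabs D.
  by rewrite ler_wpM2r //; move: k1; clear; lra.
have hR : `|Re D| <= 1 / 8 * cabs D + 2 * sigma + kap / 2 * (1 + cabs D).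
  by rewrite ler_norml; move: i1 i2; clear => *; apply/andP; split; lra.
have hI : `|Im D| <= 1 / 8 * cabs D + 2 * sigma + kap / 2 * (1 + cabs D).
  by rewrite ler_norml; move: i3 i4; clear => *; apply/andP; split; lra.
move: hk hR hI D0 se ke; clear; lra.
Qed.
End Minty.

(** * Convergence, null sets and absolute continuity *)

Section Bridging.
Local Open Scope complex_scope.
Context {R : realType}.
Local Notation Re := complex.Re.
Local Notation Im := complex.Im.
Local Notation mu := (@completed_lebesgue_measure R).
Implicit Types (a b t u h e : R) (xs : seq R).

Lemma family_pointwise (F : R -> cplx R -> cplx R) (G : cplx R -> cplx R) z :
  halfplane R z -> {family compactly_in (halfplane R), F @ 0^'+ --> G} ->
  forall e, 0 < e -> exists2 k, 0 < k & forall h, 0 < h < k -> cabs (F h z - G z) < e.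
Proof.
move=> zH FG e e0.
have : {uniform [set z], F @ 0^'+ --> G}.
  apply: (fam_cvgP _ _ _).1 FG _ _; split; first by move=> _ ->.
  exact: compact_set1.
rewrite uniform_set1 => /cvgrPdist_lt /(_ e%:C); rewrite ltcR => /(_ e0).
move=> /nbhs_ballP[k /= k0 Hk]; exists k => // h /andP[h0 hk].
have := Hk h; rewrite /ball /= sub0r normrN ger0_norm ?(ltW h0) // => /(_ hk h0).
by rewrite cabsE ltcR cabsB.
Qed.

Lemma generator_tangent (v : R -> cplx R -> cplx R) (G : cplx R -> cplx R) z :
  halfplane R z ->
  {family compactly_in (halfplane R),
        (fun (t : R) (z : cplx R) => (z - v t z) / t%:C) @ 0^'+ --> G} ->
  tangent v G z.
Proof.
move=> zH vG e e0; have [k k0 Hk] := family_pointwise zH vG e0; exists k => // h hk.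
have h0 : 0 < h by case/andP: hk.
by rewrite tangentE // ler_pM2r // ltW // Hk.
Qed.

Lemma dnbhs_cvg_cabs (f : R -> cplx R) (l : cplx R) : f @ 0^' --> l ->
  forall e, 0 < e -> exists2 k, 0 < k & forall h, h != 0 -> `|h| < k -> cabs (f h - l) < e.
Proof.
move=> /cvgrPdist_lt H e e0; have := H e%:C; rewrite ltcR => /(_ e0).
move=> /nbhs_ballP[k /= k0 Hk]; exists k => // h h0 hk.
have := Hk h; rewrite /ball /= sub0r normrN => /(_ hk h0).
by rewrite cabsE ltcR cabsB.
Qed.

Lemma seq_choose_pos (T : eqType) (s : seq T) (P : T -> R -> Prop) :
  (forall x k k', x \in s -> 0 < k' <= k -> P x k -> P x k') ->
  (forall x, x \in s -> exists2 k, 0 < k & P x k) ->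
  exists2 k, 0 < k & forall x, x \in s -> P x k.
Proof.
elim: s => [_ _|x s IH anti H]; first by exists 1.
have [||k k0 Hk] := IH.
- by move=> y k k' ys; apply: anti; rewrite inE ys orbT.
- by move=> y ys; apply: H; rewrite inE ys orbT.
have [k' k'0 Hk'] := H x (mem_head _ _).
have m0 : 0 < Num.min k k' by rewrite lt_min k0.
exists (Num.min k k') => // y; rewrite inE => /orP[/eqP ->|ys].
  by apply: anti Hk'; rewrite ?mem_head // m0 ge_min lexx orbT.
by apply: anti (Hk _ ys); rewrite ?inE ?ys ?orbT // m0 ge_min lexx.
Qed.

Lemma ae_and (P Q S : R -> Prop) : {ae mu, forall t : R, P t} ->
  {ae mu, forall t : R, Q t} -> (forall t, P t -> Q t -> S t) -> {ae mu, forall t : R, S t}.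
Proof.
move=> hP hQ PQS.
have FF : Filter (almost_everywhere mu) := ae_filter_ringOfSetsType mu.
by apply: (@filterS2 _ (almost_everywhere mu) FF) hP hQ => t; exact: PQS.
Qed.

Lemma ae_all_seq (T : eqType) (s : seq T) (P : T -> R -> Prop) :
  (forall x, x \in s -> {ae mu, forall t : R, P x t}) ->
  {ae mu, forall t : R, forall x, x \in s -> P x t}.
Proof.
elim: s => [_|x s IH H]; first by apply: aeW.
have h1 := H x (mem_head _ _).
have h2 := IH (fun y ys => H y ltac:(by rewrite inE ys orbT)).
apply: (ae_and h1 h2) => t Px Ps y; rewrite inE => /orP[/eqP -> //|]; exact: Ps.
Qed.

Lemma ae_neq (c : \bar R) : {ae mu, forall t : R, t%:E <> c}.
Proof.
case: c => [r||]; try by apply: aeW => t.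
exists [set r]; split.
- apply: sub_caratheodory; exact: measurable_set1.
- exact: (lebesgue_measure_set1 r).
- by move=> t /= /contrapT [] ->.
Qed.

Lemma ac_seq_cabs a b (f : R -> cplx R) : absolutely_continuous a b f ->
  forall e, 0 < e -> exists2 k, 0 < k &
  forall s, ordered_in a b s -> \sum_(p <- s) (p.2 - p.1) < k ->
    \sum_(p <- s) cabs (f p.2 - f p.1) < e.
Proof.
move=> acf e e0; have [k k0 Hk] := acf e e0; exists k => // s [sp sab] sk.
pose x i := (nth (a, a) s i).1; pose y i := (nth (a, a) s i).2.
have := Hk (size s) (fun i => x i) (fun i => y i).
have -> : \sum_(i < size s) (y i - x i) = \sum_(p <- s) (p.2 - p.1).
  by rewrite (big_nth (a, a)) big_mkord.
have -> : \sum_(i < size s) `|f (y i) - f (x i)| = (\sum_(p <- s) cabs (f p.2 - f p.1))%:C.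
  rewrite (big_nth (a, a)) big_mkord rmorph_sum /=; apply: eq_bigr => i _.
  by rewrite cabsE.
rewrite ltcR; apply=> //.
  by move=> i; have [] := sab (nth (a, a) s i) (mem_nth _ (ltn_ord i)).
have dis (i j : 'I_(size s)) : (i < j)%N -> `]x i, y i[ `&` `]x j, y j[ = set0.
  move=> ij; have yx : y i <= x j.
    have := pairwiseP (a, a) sp i j; rewrite !inE !ltn_ord; exact.
  apply/seteqP; split=> // r [/=]; rewrite !in_itv /= => /andP[_ r1] /andP[r2 _].
  by have := lt_trans r2 r1; rewrite ltNge yx.
move=> i j ij; have [lt|gt|e'] := ltngtP i j; [exact: dis|rewrite setIC; exact: dis|].
by move: ij; rewrite (ord_inj e') eqxx.
Qed.

(** Dominated convergence: the restrictions of [f] to [u n, t] converge to its restriction to the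
    single point [t]. *)
Lemma Rintegral_tail_cvg0 (f : R -> R) a t (u : nat -> R) : a < t ->
  mu.-integrable (`[a, t]%classic : set (lebesgueR R)) (EFin \o f) ->
  (forall x, a <= x <= t -> 0 <= f x) ->
  (forall n, a <= u n < t) -> (forall x, x < t -> \forall n \near \oo, x < u n) ->
  (fun n => (\int[mu]_(r in (`[u n, t]%classic :
    set (lebesgueR R))) f r)) @ \oo --> (0 : R).
Proof.
move=> at_ fint f0 uat ut.
pose D : set (lebesgueR R) := `[a, t]%classic.
pose J n : set (lebesgueR R) := `[u n, t]%classic.
have mI (x y : R) : measurable (`[x, y]%classic : set (lebesgueR R)).
  by apply: sub_caratheodory; exact: measurable_itv.
have m1 (x : R) : measurable ([set x] : set (lebesgueR R)).
  by apply: sub_caratheodory; exact: measurable_set1.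
have JD n : J n = D `&` J n.
  apply/seteqP; split=> [x|x []//]; rewrite /J /D /= !in_itv /= => /andP[x1 x2].
  by split; rewrite ?in_itv /= ?x1 x2 //= andbT; apply: le_trans x1; have /andP[] := uat n.
have tD : [set t] = D `&` [set t].
  by apply/seteqP; split=> [x ->|x []//]; split=> //; rewrite /D /= in_itv /= lexx ltW.
have I0 : (\int[mu]_(r in D) (((EFin \o f) \_ [set t]) r) = 0)%E.
  rewrite -integral_mkcondr -tD; apply: null_set_integral => //.
  - apply: (measurable_funS (mI a t) _ (measurable_int _ fint)).
    by rewrite tD; exact: subIsetl.
  - exact: (lebesgue_measure_set1 t).
have mf := measurable_int _ fint.
have cv : (fun n => \int[mu]_(r in D) (((EFin \o f) \_ (J n)) r))%E @ \oo --> 0%E.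
  rewrite -I0; apply: (@dominated_cvg _ _ _ _ D (mI a t) _ _ (EFin \o f)).
  - move=> n; apply/(@measurable_restrict _ _ _ _ (J n) D _ (mI _ _) (mI a t)).1.
    by rewrite -JD; apply: (measurable_funS (mI a t) _ mf); rewrite JD; exact: subIsetl.
  - move=> x; rewrite /D /= in_itv /= => /andP[ax].
    rewrite le_eqVlt => /orP[/eqP ->|xt].
      apply: cvg_near_cst; near=> n; rewrite /patch !ifT //; rewrite inE //.
      by rewrite /J /= in_itv /= lexx andbT; have /andP[_ /ltW] := uat n.
    apply: cvg_near_cst; apply: filterS (ut x xt) => n xun; rewrite /patch !ifF //.
      by apply/negbTE; rewrite notin_setE => /= xe; move: xt; rewrite xe ltxx.
    apply/negbTE; rewrite notin_setE /J /= in_itv /= => /andP[h _].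
    by have := lt_le_trans xun h; rewrite ltxx.
  - by move=> x _.
  - exact: fint.
  - move=> n x; rewrite /D /= in_itv /= => xat; rewrite /patch; case: ifP => _ /=.
      by rewrite ger0_norm ?f0.
    by rewrite normr0 lee_fin f0.
have -> : (fun n => \int[mu]_(r in (`[u n, t]%classic : set (lebesgueR R))) f r) =
   fine \o (fun n => \int[mu]_(r in D) (((EFin \o f) \_ (J n)) r))%E.
  by apply/funext => n /=; rewrite /Rintegral -integral_mkcondr -JD.
by apply: (@fine_cvg _ _ _ _ _ 0).
Unshelve. all: by end_near. Qed.
End Bridging.

(** * The two implications *)

Section Evolution.
Local Open Scope complex_scope.
Context {R : realType}.
Local Notation Re := complex.Re.
Local Notation Im := complex.Im.
Local Notation mu := (@completed_lebesgue_measure R).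
Implicit Types (a b t u h e : R) (xs : seq R).

Lemma Hol_id : Hol (halfplane R) (halfplane R) (id : cplx R -> cplx R).
Proof. by split=> // z _; exact: derivable_id. Qed.

Lemma BF_id : BF R (id : cplx R -> cplx R).
Proof.
split; first by split=> // z _; exact: derivable_id.
exists (fun x => x); split=> //; first exact: bernstein_id.
by exists 1 => //; rewrite oner_neq0.
Qed.

Lemma time_interval_sub (T : \bar R) (I : set R) : time_interval T I ->
  [/\ forall t, I t -> 0 <= t /\ (t%:E <= T)%E,
      forall t, 0 <= t -> (t%:E < T)%E -> I t &
      forall s t u, I s -> I t -> s <= u -> u <= t -> I u].
Proof.
move=> [T0 IE]; split.
- by move=> t; case: IE => [->|[_ ->]] /= [t0 tT]; split=> //; exact: ltW.
- by move=> t t0 tT; case: IE => [->|[_ ->]] //=; split=> //; exact: ltW.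
- move=> s t u; case: IE => [->|[_ ->]] /= [s0 _] [_ tT] su ut; split.
  + exact: le_trans su.
  + by apply: le_lt_trans tT; rewrite lee_fin.
  + exact: le_trans su.
  + by apply: le_trans tT; rewrite lee_fin.
Qed.

(** Compactness by real induction; for the real part of a trajectory it makes the constant in
    [bernstein_dist_step] uniform in time. *)
Lemma unif_lower_bound (f : R -> R) a b : a <= b ->
  (forall e, 0 < e -> exists2 k, 0 < k &
     forall u v, a <= u -> u <= v -> v <= b -> v - u < k -> `|f v - f u| < e) ->
  (forall u, a <= u <= b -> 0 < f u) ->
  exists2 c, 0 < c & forall u, a <= u <= b -> c <= f u.
Proof.
move=> ab uc f0.
pose P t := exists2 c, 0 < c & forall u, a <= u <= t -> c <= f u.
apply: (@real_induction R P a b ab).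
- exists (f a); first by apply: f0; rewrite lexx.
  by move=> u; rewrite -eq_le => /eqP <-.
- move=> t /andP[at_ tb] [c c0 Hc].
  have ft : 0 < f t / 2 by rewrite divr_gt0 // f0 // at_ ltW.
  have [k k0 Hk] := uc _ ft; exists k => // h /andP[h0 hk] thb.
  exists (Num.min c (f t / 2)); first by rewrite lt_min c0.
  move=> u /andP[au uth]; rewrite ge_min; have [ut|tu] := leP u t.
    by rewrite Hc // au.
  have := Hk t u at_ (ltW tu) ltac:(lra) ltac:(lra).
  by rewrite ltr_norml => /andP[? _]; apply/orP; right; lra.
- move=> t /andP[at_ tb] H.
  have ft : 0 < f t / 2 by rewrite divr_gt0 // f0 // (ltW at_).
  have [k k0 Hk] := uc _ ft.
  pose u0 := Num.max a (t - k / 2).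
  have au : a <= u0 by rewrite le_max lexx.
  have uk : t - k / 2 <= u0 by rewrite le_max lexx orbT.
  have ut : u0 < t by rewrite gt_max at_; lra.
  have [c c0 Hc] := H u0 ltac:(by rewrite au).
  exists (Num.min c (f t / 2)); first by rewrite lt_min c0.
  move=> u /andP[au' ut']; rewrite ge_min; have [uu|uu] := leP u u0.
    by rewrite Hc // au'.
  have := Hk u t au' ut' tb ltac:(lra).
  by rewrite ltr_norml => /andP[_ ?]; apply/orP; right; lra.
Qed.

Lemma sumr_le_size (T : eqType) (s : seq T) (F : T -> R) (c : R) :
  (forall x, x \in s -> F x <= c) -> \sum_(x <- s) F x <= (size s)%:R * c.
Proof.
move=> H; rewrite big_seq (le_trans (ler_sum _ H)) // -big_seq.
by rewrite big_const_seq count_predT iter_addr_0 mulr_natl.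
Qed.

Lemma evolution_BF (T : \bar R) (I : set R)
    (w : R -> R -> cplx R -> cplx R) (phi : cplx R -> R -> cplx R) s t0 :
  time_interval T I -> evolution_family I w -> associated T I w phi ->
  {ae mu, forall t : R, I t -> generators (BF R) (phi^~ t)} ->
  I s -> I t0 -> s <= t0 -> BF R (w s t0).
Proof.
move=> TI [wH w1 _ _] assoc gen Is It0 st0.
have [I0 _ Isub] := time_interval_sub TI.
apply: bernstein_dist_le0_BF; first exact: wH.
move=> xs xs0; pose X t x := w s t x%:C; rewrite -/(X t0).
have xH x : x \in xs -> halfplane R x%:C by move/xs0.
have Xs : bernstein_dist xs (X s) <= 0.
  apply: le_trans (bernstein_dist_id xs0).
  rewrite le_eqVlt; apply/orP; left; apply/eqP; rewrite /bernstein_dist; congr inf.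
  suff E g : \sum_(x <- xs) pdist (X s x) (g x)%:C = \sum_(x <- xs) pdist x%:C (g x)%:C.
    by apply/seteqP; split=> y [g Bg <-]; exists g.
  by rewrite big_seq [RHS]big_seq; apply: eq_bigr => x /xH xx; rewrite /X w1.
move: st0; rewrite le_eqVlt => /orP[/eqP <- //|st0].
apply: le_trans Xs; pose d t := bernstein_dist xs (X t); rewrite -/(d t0) -/(d s).
have sT : (s%:E < T)%E by apply: lt_le_trans (I0 _ It0).2; rewrite lte_fin.
have s0 := (I0 _ Is).1.
have Ist u : s <= u <= t0 -> I u by move=> /andP[]; exact: Isub.
have XH t x : s <= t <= t0 -> x \in xs -> 0 < Re (X t x).
  move=> stt0 /xH xx; apply: (wH s t Is (Ist _ stt0) _).2 => //; by case/andP: stt0.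
have Xac x : x \in xs -> absolutely_continuous s t0 (fun t => X t x).
  move=> /xH xx; have [_ + _] := assoc x%:C s xx s0 sT; exact.
have [c c0 Hc] : exists2 c, 0 < c & forall x, x \in xs -> forall t, s <= t <= t0 ->
  c <= Re (X t x).
  apply: seq_choose_pos => [x k k' _ /andP[_ k'k] H t stt|x xx].
    by apply: le_trans k'k _; exact: H.
  apply: unif_lower_bound => [|e e0|u su]; [exact: ltW| |exact: XH].
  have [k k0 Hk] := ac_seq_cabs (Xac x xx) e0; exists k => // u v su uv vt vuk.
  have := Hk [:: (u, v)]; rewrite !big_seq1 /= => h.
  rewrite -ReB; apply: le_lt_trans (Re_le_cabs _) _; apply: h => //.
  by split=> // p; rewrite inE => /eqP ->.
pose L := 2 / c.
have L0 : 0 < L by rewrite divr_gt0.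
have dstep (k : cplx R -> cplx R) t t' : Hol (halfplane R) (halfplane R) k -> BF R k ->
    s <= t <= t0 -> s <= t' <= t0 ->
    d t' <= d t + L * \sum_(x <- xs) cabs (X t' x - k (X t x)).
  move=> Hk Bk st st'; apply: (le_trans (@bernstein_dist_step _ xs (X t) (X t') k _ Hk Bk)).
    by move=> x xx; split; [exact: xs0|exact: XH|exact: XH].
  rewrite lerD2l big_distrr /= big_seq [leRHS]big_seq; apply: ler_sum => x xx.
  have cx := Hc x xx t' st'; have X0 := XH t' x st' xx.
  rewrite ler_pdivrMr // /L.
  have := ler_wpM2l (cabs_ge0 (X t' x - k (X t x))) cx => h.
  have -> : 2 / c * cabs (X t' x - k (X t x)) * Re (X t' x) =
    2 / c * (cabs (X t' x - k (X t x)) * Re (X t' x)) by ring.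
  apply: (@le_trans _ _ (2 / c * (cabs (X t' x - k (X t x)) * c)));
    last by rewrite ler_pM2l.
  by rewrite le_eqVlt; apply/orP; left; apply/eqP; field; rewrite gt_eqF.
pose n := (size xs)%:R : R.
have n0 : 0 < n + 1 by rewrite ltr_wpDl.
(* With the identity as comparison map, [d] varies at most [L] times as much as the points together,
   so absolute continuity passes from the trajectories to [d]. *)
have dac : seq_ac s t0 d.
  move=> e e0.
  have e1 : 0 < e / (L * (n + 1)) by rewrite divr_gt0 // mulr_gt0.
  have [k k0 Hk] : exists2 k, 0 < k & forall x, x \in xs -> forall l, ordered_in s t0 l ->
      \sum_(p <- l) (p.2 - p.1) < k -> \sum_(p <- l) cabs (X p.2 x - X p.1 x) < e / (L
        * (n + 1)).
    apply: seq_choose_pos => [x k k' _ /andP[_ k'k] H l ol lk|x xx].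
      by apply: H => //; exact: lt_le_trans k'k.
    exact: ac_seq_cabs (Xac x xx) _ e1.
  exists k => // l ol lk.
  have bnd : \sum_(p <- l) `|d p.2 - d p.1| <=
    L * \sum_(x <- xs) \sum_(p <- l) cabs (X p.2 x - X p.1 x).
    rewrite exchange_big /= big_distrr /= big_seq [leRHS]big_seq; apply: ler_sum => p pl.
    have [h1 h2 h3] := ol.2 p pl.
    have st1 : s <= p.1 <= t0 by rewrite h1 (le_trans h2).
    have st2 : s <= p.2 <= t0 by rewrite h3 (le_trans h1).
    have d12 := dstep _ p.1 p.2 Hol_id BF_id st1 st2.
    have d21 := dstep _ p.2 p.1 Hol_id BF_id st2 st1.
    have sw : \sum_(x <- xs) cabs (X p.1 x - X p.2 x) =
      \sum_(x <- xs) cabs (X p.2 x - X p.1 x).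
      by apply: eq_bigr => x _; rewrite cabsB.
    rewrite sw in d21; rewrite ler_norml; move: d12 d21; clear => *.
    by apply/andP; split; lra.
  apply: (le_lt_trans bnd).
  have : \sum_(x <- xs) \sum_(p <- l) cabs (X p.2 x - X p.1 x) <= n * (e / (L * (n + 1))).
    by apply: sumr_le_size => x xx; apply: ltW; exact: Hk.
  rewrite -(ler_pM2l L0) => /le_lt_trans; apply.
  have -> : L * (n * (e / (L * (n + 1)))) = e * (n / (n + 1)).
    by field; rewrite !gt_eqF.
  by rewrite gtr_pMr // ltr_pdivrMr // mul1r ltrDl.
have good : {ae mu, forall t : R, (I t -> generators (BF R) (phi^~ t)) /\
   forall x, x \in xs -> I t -> s <= t ->
     (fun h : R => (w s (t + h) x%:C - w s t x%:C) / h%:C) @ 0^' --> - phi (w s t x%:C) t}.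
  apply: (ae_and gen) => [|t h1 h2]; last by split; [exact: h1|exact: h2].
  by apply: ae_all_seq => x /xH xx; have [] := assoc x%:C s xx s0 sT.
apply: (ac_nonincr (ltW st0) dac good) => t /andP[st tt0] /contrapT[Gt At] e e0.
have It : I t by apply: Ist; rewrite st ltW.
have [_ [v [vBF _ _ _] vG]] := Gt It.
(* Two errors of this size, from the derivative of the flow and from the tangency of [v], are summed
   over the list and multiplied by [L], for a total of at most [e * h]; [n + 1] also covers the
   empty list. *)
have e1 : 0 < e / (2 * L * (n + 1)) by rewrite divr_gt0 // mulr_gt0 // mulr_gt0.
have stt0 : s <= t <= t0 by apply/andP; split=> //; exact: ltW.
have [k k0 Hk] : exists2 k, 0 < k & forall x, x \in xs -> forall h, 0 < h < k ->
    cabs (X (t + h) x - v h (X t x)) <= 2 * (e / (2 * L * (n + 1))) * h.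
  apply: seq_choose_pos => [x k k' _ /andP[_ k'k] H h /andP[h0 hk]|x xx].
    by apply: H; rewrite h0 (lt_le_trans hk).
  have [k1 k10 H1] := dnbhs_cvg_cabs (At x xx It st) e1.
  have [k2 k20 H2] := generator_tangent (XH t x stt0 xx) vG e1.
  exists (Num.min k1 k2) => [|h]; first by rewrite lt_min k10.
  rewrite lt_min => /andP[h0 /andP[hk1 hk2]].
  have := H1 h (lt0r_neq0 h0); rewrite ger0_norm ?(ltW h0) // => /(_ hk1) i1.
  have := H2 h; rewrite h0 hk2 => /(_ isT) i2.
  have hC : h%:C != 0 :> R[i] by rewrite (inj_eq (@complexI R)) gt_eqF.
  have -> : X (t + h) x - v h (X t x) =
     h%:C * ((X (t + h) x - X t x) / h%:C - - phi (X t x) t) - (v h (X t x) - X t x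
       + h%:C * phi (X t x) t).
    by field.
  apply: (le_trans (cabsD _ _)); rewrite cabsN cabsM cabs_real ger0_norm ?(ltW h0) //.
  have := ler_wpM2l (ltW h0) (ltW i1); rewrite -/(X (t + h) x) -/(X t x).
  by move: i2; clear; lra.
exists k => // h hk thb; have h0 : 0 < h by case/andP: hk.
have [vH vB] := vBF h (ltW h0).
have st' : s <= t + h <= t0 by rewrite thb andbT (le_trans st) // lerDl ltW.
apply: (le_trans (dstep (v h) t (t + h) vH vB stt0 st')); rewrite lerD2l.
have : \sum_(x <- xs) cabs (X (t + h) x - v h (X t x)) <=
  n * (2 * (e / (2 * L * (n + 1))) * h).
  by apply: sumr_le_size => x xx; exact: Hk.
rewrite -(ler_pM2l L0) => /le_trans; apply.
have -> : L * (n * (2 * (e / (2 * L * (n + 1))) * h)) = e * h * (n / (n + 1)).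
  by field; rewrite !gt_eqF.
by rewrite ler_piMr ?mulr_ge0 ?(ltW e0) ?(ltW h0) // ler_pdivrMr // mul1r lerDl.
Qed.
End Evolution.

(** * The semigroup generated by a frozen field *)

Section Generators.
Local Open Scope complex_scope.
Context {R : realType}.
Local Notation Re := complex.Re.
Local Notation Im := complex.Im.
Local Notation mu := (@completed_lebesgue_measure R).
Implicit Types (a b t u h e : R) (xs : seq R).

(** Semicontinuity of [d] from the left rests on convergence at time 0 alone: the points at times
    [v'] and [t] are images under [v v'] of [x] and [v (t - v') x], so Schwarz-Pick bounds their
    distance by that of the latter pair. *)
Lemma semigroup_BF (v F : R -> cplx R -> cplx R) (phi : cplx R -> cplx R) h0 :
  one_param_semigroup (Hol (halfplane R) (halfplane R)) v ->
  {family compactly_in (halfplane R),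
        (fun (t : R) (z : cplx R) => (z - v t z) / t%:C) @ 0^'+ --> phi} ->
  0 < h0 -> (forall h, 0 < h < h0 -> Hol (halfplane R) (halfplane R) (F h) /\ BF R (F h)) ->
  (forall q, halfplane R q -> tangent F phi q) ->
  forall r, 0 <= r -> BF R (v r).
Proof.
move=> [vH v0 vD vid] vphi h00 FH Ftan r r0.
apply: bernstein_dist_le0_BF; first exact: (vH r r0).1.
move=> xs xs0; pose X t x := v t x%:C; pose d t := bernstein_dist xs (X t);
  rewrite -/(X r) -/(d r).
have xH x : x \in xs -> halfplane R x%:C by move/xs0.
have vHH t z : 0 <= t -> halfplane R z -> halfplane R (v t z).
  by move=> t0; exact: (vH t t0).1.2.
have XH t x : 0 <= t -> x \in xs -> 0 < Re (X t x) by move=> t0 /xH; exact: vHH.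
have d0 : d 0 <= 0.
  apply: le_trans (bernstein_dist_id xs0).
  rewrite le_eqVlt; apply/orP; left; apply/eqP; rewrite /d /bernstein_dist; congr inf.
  suff E g : \sum_(x <- xs) pdist (X 0 x) (g x)%:C = \sum_(x <- xs) pdist x%:C (g x)%:C.
    by apply/seteqP; split=> y [g Bg <-]; exists g.
  by rewrite big_seq [RHS]big_seq; apply: eq_bigr => x /xH xx; rewrite /X v0.
apply: le_trans d0.
pose n := (size xs)%:R : R.
have n0 : 0 < n + 1 by rewrite ltr_wpDl.
apply: (dini_nonincr r0) => [t /andP[t0 tr]|t /andP[t0 tr]] e e0.
  (* The 8 combines the 2 of [bernstein_dist_step] with the 4 of [cabs_le_pdist], which asks for a
     distance at most 1/2. *)
  have e1 : 0 < Num.min (e / (8 * (n + 1))) (1 / 2).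
    by rewrite lt_min !divr_gt0 // mulr_gt0.
  have [k k0 Hk] : exists2 k, 0 < k & forall x, x \in xs -> forall h, 0 < h < k ->
      pdist (v h x%:C) x%:C < Num.min (e / (8 * (n + 1))) (1 / 2).
    apply: seq_choose_pos => [x k k' _ /andP[_ k'k] H h /andP[hp hk]|x xx].
      by apply: H; rewrite hp (lt_le_trans hk).
    have x0 := xs0 x xx.
    have [k k0 Hk] := family_pointwise (xH x xx) vid (mulr_gt0 e1 x0).
    exists k => // h hk; have hp : 0 < h by case/andP: hk.
    apply: (le_lt_trans (@pdist_le_cabs R _ x%:C _ x0));
      first exact: (vHH h _ (ltW hp) (xH x xx)).
    rewrite /= ltr_pdivrMr //; exact: Hk.
  exists (Num.max 0 (t - k / 2)).
    by rewrite le_max lexx /= gt_max t0 /=; lra.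
  move=> v' /andP[]; rewrite ge_max => /andP[v'0 v'k] v't.
  have ht : 0 < t - v' < k by apply/andP; split; lra.
  have hp : 0 <= t - v' by lra.
  apply: (le_trans (@bernstein_dist_step _ xs (X v') (X t) id _ Hol_id BF_id)).
    by move=> x xx; split; [exact: xs0|exact: XH|apply: XH; rewrite // ltW].
  rewrite lerD2l.
  apply: (@le_trans _ _ (n * (e / (n + 1)))); last first.
    have -> : n * (e / (n + 1)) = e * (n / (n + 1)) by ring.
    by rewrite ler_piMr ?(ltW e0) // ler_pdivrMr // mul1r lerDl.
  apply: sumr_le_size => x xx.
  have Xt : X t x = v v' (v (t - v') x%:C).
    by rewrite (vD _ _ _ v'0 hp (xH x xx)) addrC subrK.
  have X0 : 0 < Re (X t x) by apply: XH; rewrite // ltW.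
  have := Hk x xx _ ht; rewrite lt_min => /andP[p1 p2].
  have pX : pdist (X t x) (X v' x) <= pdist (v (t - v') x%:C) x%:C.
    rewrite Xt; apply: schwarz_pick; [exact: (vH v' v'0).1| |exact: xs0].
    exact: (vHH _ _ hp (xH x xx)).
  have := cabs_le_pdist X0 (XH v' x v'0 xx) ltac:(lra).
  rewrite ler_pdivrMr //= => h4.
  have h5 : pdist (X t x) (X v' x) * 8 <= e / (n + 1).
    have : e / (8 * (n + 1)) * 8 = e / (n + 1) by field; rewrite gt_eqF.
    lra.
  have := ler_wpM2r (ltW X0) h5; lra.
have e1 : 0 < e / (8 * (n + 1)) by rewrite divr_gt0 // mulr_gt0.
have [k k0 Hk] : exists2 k, 0 < k & forall x, x \in xs -> forall h, 0 < h < k ->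
    2 * cabs (X (t + h) x - F h (X t x)) / Re (X (t + h) x) <= e / (n + 1) * h.
  apply: seq_choose_pos => [x k k' _ /andP[_ k'k] H h /andP[hp hk]|x xx].
    by apply: H; rewrite hp (lt_le_trans hk).
  pose q := X t x; have q0 : 0 < Re q by exact: XH.
  (* Two errors of this size, doubled and divided by a real part of at least [Re q / 2], amount to
     [e / (n + 1) * h]. *)
  have e2 : 0 < e / (8 * (n + 1)) * Re q by rewrite mulr_gt0.
  have q2 : 0 < Re q / 2 by lra.
  have [k1 k10 H1] := generator_tangent q0 vphi e2.
  have [k2 k20 H2] := Ftan q q0 _ e2.
  have [k3 k30 H3] := family_pointwise q0 vid q2.
  exists (Num.min (Num.min k1 k2) k3); first by rewrite !lt_min k10 k20 k30.
  move=> h; rewrite !lt_min => /andP[hp /andP[/andP[hk1 hk2] hk3]].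
  have i1 := H1 h ltac:(by rewrite hp); have i2 := H2 h ltac:(by rewrite hp).
  have i3 := H3 h ltac:(by rewrite hp).
  have XE : X (t + h) x = v h q.
    by rewrite /q /X (vD _ _ _ (ltW hp) t0 (xH x xx)) addrC.
  have Rq : Re q / 2 <= Re (X (t + h) x).
    rewrite XE; have := le_lt_trans (Re_le_cabs _) i3; rewrite ReB ltr_norml => /andP[];
      lra.
  have RX : 0 < Re (X (t + h) x) by lra.
  rewrite ler_pdivrMr // -/q XE.
  have -> : v h q - F h q = (v h q - q + h%:C * phi q) - (F h q - q + h%:C * phi q) by ring.
  have := cabsD (v h q - q + h%:C * phi q) (- (F h q - q + h%:C * phi q)); rewrite cabsN.
  have i5 : 4 * (e / (8 * (n + 1)) * Re q * h) <= e / (n + 1) * h * Re (v h q).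
    have -> : 4 * (e / (8 * (n + 1)) * Re q * h) = e / (n + 1) * h * (Re q / 2).
      by field; rewrite gt_eqF.
    by rewrite ler_wpM2l -?XE // mulr_ge0 ?divr_ge0 // ltW.
  lra.
exists (Num.min k h0) => [|h]; first by rewrite lt_min k0.
rewrite lt_min => /andP[hp /andP[hk' hh0]] _.
have hk : 0 < h < k by rewrite hp.
have [FhH FhB] := FH h ltac:(by rewrite hp).
apply: (le_trans (@bernstein_dist_step _ xs (X t) (X (t + h)) _ _ FhH FhB)).
  by move=> x xx; split; [exact: xs0|exact: XH|apply: XH; rewrite // addr_ge0 // ltW].
rewrite lerD2l; apply: (@le_trans _ _ (n * (e / (n + 1) * h))).
  by apply: sumr_le_size => x xx; exact: Hk.
have -> : n * (e / (n + 1) * h) = e * h * (n / (n + 1)) by ring.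
by rewrite ler_piMr ?mulr_ge0 ?(ltW e0) ?(ltW hp) // ler_pdivrMr // mul1r lerDl.
Qed.
End Generators.

(** * Tangency along countably many trajectories, and the equivalence *)

Section Main.
Local Open Scope complex_scope.
Context {R : realType}.
Local Notation Re := complex.Re.
Local Notation Im := complex.Im.
Local Notation mu := (@completed_lebesgue_measure R).
Implicit Types (a b t u h e : R) (xs : seq R).

Lemma rat_between a b : a < b -> exists q : rat, a < ratr q < b.
Proof. by move=> /rat_in_itvoo[q]; rewrite in_itv /= => qab; exists q. Qed.

Lemma rat_cplx_dense (p : R[i]) e : 0 < Re p -> 0 < e ->
  exists x y : rat, 0 < ratr x :> R /\ cabs (ratr x +i* ratr y - p) < e.
Proof.
move=> p0 e0.
have [x /andP[x1 x2]] := rat_between (ltac:(lra) : Re p < Re p + e / 2).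
have [y /andP[y1 y2]] := rat_between (ltac:(lra) : Im p < Im p + e / 2).
exists x, y; split; first by lra.
apply: (le_lt_trans (cabs_le_ReIm _)); rewrite ReB ImB /= !ger0_norm; lra.
Qed.

(** Condition EF3 with both earlier times equal to the starting time bounds the displacement by a
    tail integral ending at [t], of one function for all starting times. This makes the points
    reached at time [t] by rational trajectories dense. *)
Lemma evolution_left_limit (T : \bar R) (I : set R)
    (w : R -> R -> cplx R -> cplx R) t z e :
  time_interval T I -> evolution_family I w -> I t -> halfplane R z -> 0 < e ->
  exists2 q : rat, (0 : R) <= ratr q <= t & cabs (w (ratr q) t z - z) < e.
Proof.
move=> TI [wH w1 _ ef3] It zH e0.
have [I0 Iin Isub] := time_interval_sub TI.
have t0 := (I0 t It).1.
have Izero : I 0 by apply: Iin => //; case: TI.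
move: t0; rewrite le_eqVlt => /orP[/eqP t0|t0].
  exists 0; first by rewrite rmorph0 lexx t0 lexx.
  by rewrite rmorph0 t0 w1 // subrr cabs0.
have [f [[mf fint] f0 Hf]] := ef3 z zH.
have uq n : exists q : rat, Num.max 0 (t - n.+1%:R^-1) < ratr q < t.
  have n0 : 0 < n.+1%:R^-1 :> R by rewrite invr_gt0 ltr0n.
  by apply: rat_between; rewrite gt_max t0 /= gtrBl.
have [u Hu] := choice uq.
have u0 n : (0 : R) <= ratr (u n) < t.
  by have := Hu n; rewrite gt_max => /andP[/andP[/ltW -> _] ->].
have sub0t : `[0, t]%classic `<=` I.
  by move=> x /=; rewrite in_itv /= => /andP[x0 xt]; exact: Isub Izero It x0 xt.
have ut x : x < t -> \forall n \near \oo, x < ratr (u n).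
  rewrite -subr_gt0 => xt; near=> n.
  have := Hu n; rewrite gt_max => /andP[/andP[_ h] _].
  have : n.+1%:R^-1 < t - x by near: n; exact: (near_infty_natSinv_lt (PosNum xt)).
  move: (n.+1%:R^-1) h => r; lra.
have f0' x : 0 <= x <= t -> 0 <= f x.
  by move=> xt; apply: f0; apply: sub0t; rewrite /= in_itv.
have cv := @Rintegral_tail_cvg0 R f 0 t (fun n => ratr (u n)) t0 (fint 0 t sub0t) f0' u0 ut.
have := (cvgrPdist_lt _ _).1 cv e e0 => -[N _ HN].
have := HN N (leqnn N) => /=; rewrite sub0r normrN => hN.
have [q0 qt] := andP (u0 N).
exists (u N); first by rewrite q0 ltW.
have Iq : I (ratr (u N)) by apply: Isub Izero It q0 (ltW qt).
have := Hf _ _ _ Iq Iq It (lexx _) (ltW qt); rewrite w1 // cabsE lecR => /le_lt_trans;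
  apply.
exact: le_lt_trans (ler_norm _) hN.
Unshelve. all: by end_near. Qed.

Lemma generators_BF (T : \bar R) (I : set R)
    (w : R -> R -> cplx R -> cplx R) (phi : cplx R -> R -> cplx R) :
  time_interval T I -> evolution_family I w -> herglotz_vector_field I phi ->
  associated T I w phi ->
  (forall s t, I s -> I t -> s <= t -> BF R (w s t)) ->
  {ae mu, forall t : R, I t -> generators (BF R) (phi^~ t)}.
Proof.
move=> TI ef [gen _ _] assoc wBF.
have [wH w1 w2 _] := ef.
have [I0 Iin Isub] := time_interval_sub TI.
(* [i] codes a rational starting time and a starting point with rational coordinates: countably many
   trajectories, hence a single null set of bad times. *)
pose Q (i : rat * (rat * rat)) (t : R) :=
  let s : R := ratr i.1 in let z : cplx R := ratr i.2.1 +i* ratr i.2.2 in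
  0 <= s -> (s%:E < T)%E -> halfplane R z -> I t -> s <= t ->
  (fun h : R => (w s (t + h) z - w s t z) / h%:C) @ 0^' --> - phi (w s t z) t.
have aeQ : {ae mu, forall t : R, forall n : nat, forall i, unpickle n = Some i -> Q i t}.
  apply: ae_foralln => n; case: (unpickle n) => [i|]; last by apply: aeW.
  have [s0|s0] := leP 0 (ratr i.1 : R); last first.
    by apply: aeW => t j [<-] /=; rewrite /Q /= leNgt s0.
  have [sT|sT] := boolP ((ratr i.1)%:E < T)%E; last first.
    by apply: aeW => t j [<-] /=; rewrite /Q /= (negbTE sT).
  have [zH|zH] := pselect (halfplane R (ratr i.2.1 +i* ratr i.2.2)); last first.
    by apply: aeW => t j [<-]; rewrite /Q => /= _ _ h; case: (zH h).
  have [_ _ h] := assoc _ _ zH s0 sT.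
  by apply: (ae_and h h) => t ht _ j [<-]; rewrite /Q => /= _ _ _; exact: ht.
(* The time [T], if it lies in [I], leaves no room for [t + h] and is discarded. *)
apply: (ae_and aeQ (@ae_neq R T)) => t Qt tT It.
have [_ tleT] := I0 t It.
have ltT : (t%:E < T)%E by rewrite lt_neqAle tleT andbT; apply/eqP.
have t0 := (I0 t It).1.
have [h0 h00 Ih] : exists2 h0, 0 < h0 & forall h, 0 < h < h0 -> I (t + h).
  have [[r rT tr]|rT] : (exists2 r, T = r%:E & t < r) \/ T = +oo%E.
  - by case: (T) ltT => [r tr||//]; [left; exists r|right].
  - exists (r - t) => [|h /andP[hp hr]]; first by rewrite subr_gt0.
    by apply: Iin; [lra|rewrite rT lte_fin; lra].
  - exists 1 => // h /andP[hp _]; apply: Iin; [lra|rewrite rT; exact: ltry].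
have [Hphi [v vsg vphi]] := gen t It.
(* The field already generates a semigroup [v] of self-maps of the half-plane; it remains to place
   each [v r] in [BF R]. *)
suff vBF : one_param_semigroup (BF R) v by split; [exact: Hphi|exists v].
pose F h := w t (t + h).
have FH h : 0 < h < h0 -> Hol (halfplane R) (halfplane R) (F h) /\ BF R (F h).
  move=> hh; have hp : t <= t + h by rewrite lerDl; case/andP: hh => /ltW.
  by split; [apply: wH|apply: wBF] => //; exact: Ih.
have Ftan q : halfplane R q -> tangent F (phi^~ t) q.
  move=> qH.
  pose E : set R[i] := [set p | exists i : rat * (rat * rat),
     [/\ (0 : R) <= ratr i.1 <= t, halfplane R (ratr i.2.1 +i* ratr i.2.2) &
       p = w (ratr i.1) t (ratr i.2.1 +i* ratr i.2.2)]].
  have Iq (s : R) : 0 <= s <= t -> I s.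
    move=> /andP[s0 st]; apply: Iin => //; apply: le_lt_trans ltT; by rewrite lee_fin.
  apply: (@tangent_dense R F (phi^~ t) E h0 q h00) => //.
  - by move=> h hh; exact: (FH h hh).1.
  - move=> p [i [it iH ->]]; have st : ratr i.1 <= t by case/andP: it.
    exact: (wH _ _ (Iq _ it) It st).2.
  - move=> p e p0 e0; have e2 : 0 < e / 2 by lra.
    have [x [y [x0 xyp]]] := rat_cplx_dense p0 e2.
    have [s st wz] := @evolution_left_limit T I w t (ratr x +i* ratr y) _ TI ef It x0 e2.
    exists (w (ratr s) t (ratr x +i* ratr y)); first by exists (s, (x, y)).
    rewrite -(subrK (ratr x +i* ratr y) (w _ _ _)) -addrA.
    by apply: (le_lt_trans (cabsD _ _)); lra.
  - move=> p [i [it iH pE]] e e0.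
    have [s0 st] := andP it.
    have sT : ((ratr i.1)%:E < T)%E by apply: le_lt_trans ltT; rewrite lee_fin.
    have conv := Qt (pickle i) i (pickleK i) s0 sT iH It st.
    have [k k0 Hk] := dnbhs_cvg_cabs conv e0.
    exists (Num.min k h0) => [|h]; first by rewrite lt_min k0.
    rewrite lt_min => /andP[hp /andP[hk hh0]].
    have := Hk h (lt0r_neq0 hp); rewrite ger0_norm ?(ltW hp) // => /(_ hk).
    have Ith : I (t + h) by apply: Ih; rewrite hp.
    have tth : t <= t + h by rewrite lerDl ltW.
    (* By EF2 the trajectory after time [t] is [F h] applied to [p], so its derivative at [t] is
       tangency of [F] at [p]. *)
    rewrite (w2 _ _ _ _ (Iq _ it) It Ith st tth iH) -pE -/(F h) => /ltW.
    have <- : - ((p - F h p) / h%:C - phi p t) = (F h p - p) / h%:C - - phi p t by ring.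
    by rewrite cabsN tangentE // ler_pM2r.
  - exact: Hphi.1.
have [vH v0 vD vid] := vsg.
split; [move=> r r0; split; first exact: (vH r r0).1|exact: v0|exact: vD|exact: vid].
exact: (semigroup_BF vsg vphi h00 FH Ftan r0).
Qed.
End Main.

Theorem corollary3p3 (R : realType) (T : \bar R) (I : set R)
    (w : R -> R -> cplx R -> cplx R) (phi : cplx R -> R -> cplx R) :
  time_interval T I ->
  evolution_family I w ->
  herglotz_vector_field I phi ->
  associated T I w phi ->
  (forall s t, I s -> I t -> s <= t -> BF R (w s t)) <->
  {ae @completed_lebesgue_measure R, forall t : R, I t ->
    generators (BF R) (phi^~ t)}.
Proof.
move=> TI ef herg assoc; split; first exact: generators_BF herg assoc.
by move=> gen s t; exact: evolution_BF assoc gen.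
Qed.
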